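(* Let $\beta\in(-\infty,0)\cup(0,1]$, $G_\beta(u)=\frac{\beta}{|\beta|}u^\beta$, $L\in\mathbb{N}$, $d>0$, and $u_0\in\mathcal{P}_{L,d}$. Then there exists a solution $u$ on $[0,\infty)$ of $\partial_tu=\Delta G_\beta(u)$, $u(0)=u_0$, and a constant $c=c(L,d,\beta,\|u_0\|_\infty)>0$ such that: 1. if $\beta\in(-\infty,0)\cup(0,1)$, then $u(t,k)\ge c\,(1\wedge t^{\frac1{1-\beta}})$ for all $t\ge0$, $k\in\mathbb{Z}$; 2. if $\beta=1$, then $u(t,k)\ge c\,e^{-2t}I_L(2t)$ for all $t\ge0$, $k\in\mathbb{Z}$; 3. (comparison principle) if $c_1\le u_0\le c_2$, then $c_1\le u(t,\cdot)\le c_2$ for all $t\ge0$.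
   Context: $\Delta v(k)=v(k-1)-2v(k)+v(k+1)$. For $u\in\ell^\infty_+(\mathbb{Z})$ and $d>0$ let $\sigma_+(u,k,d)=\inf\{l>k:u(l)\ge d\}$, and $\mathcal{P}_{L,d}=\{u\in\ell^\infty_+(\mathbb{Z}):\sup_{k\in\mathbb{Z}}(\sigma_+(u,k,d)-k)\le L\}$. A solution is a map $u:[0,\infty)\to\ell^\infty_+(\mathbb{Z})$ with $u\in C^0([0,\infty);\ell^\infty_+(\mathbb{Z}))$, $u(0)=u_0$, and for every $k$, $u(\cdot,k)\in C^1((0,\infty);(0,\infty))$ with $\frac{d}{dt}u(t,k)=\Delta G_\beta(u)(t,k)$ for all $t>0$. $I_L$ is the modified Bessel function of the first kind of order $L$, $I_L(s)=\frac1\pi\int_0^\pi e^{s\cos\theta}\cos(L\theta)\,d\theta$. *)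

(* Defs.v *)
From Stdlib Require Import Reals ZArith Lra.
From Coquelicot Require Import Coquelicot.
Open Scope R_scope.

Definition Delta (v : Z -> R) (k : Z) : R :=
  v (k - 1)%Z - 2 * v k + v (k + 1)%Z.

Definition linf_plus (u : Z -> R) : Prop :=
  (forall k, 0 <= u k) /\ exists M, forall k, Rabs (u k) <= M.

Definition linf_norm (u : Z -> R) : R :=
  real (Lub_Rbar (fun x => exists k : Z, x = Rabs (u k))).

(* sigma_+(u,k,d) = inf { l > k : u(l) >= d }  (in Rbar; +oo if empty) *)
Definition sigma_plus (u : Z -> R) (k : Z) (d : R) : Rbar :=
  Glb_Rbar (fun x => exists l : Z, (k < l)%Z /\ d <= u l /\ x = IZR l).

Definition P_Ld (L : nat) (d : R) (u : Z -> R) : Prop :=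
  linf_plus u /\
  forall k : Z, Rbar_le (Rbar_minus (sigma_plus u k d) (Finite (IZR k))) (Finite (INR L)).

Definition G (beta x : R) : R := beta / Rabs beta * Rpower x beta.

Definition is_solution (beta : R) (u0 : Z -> R) (u : R -> Z -> R) : Prop :=
  (forall t, 0 <= t -> linf_plus (u t)) /\
  (forall t0, 0 <= t0 -> forall eps, 0 < eps -> exists delta, 0 < delta /\
     forall t, 0 <= t -> Rabs (t - t0) < delta ->
       forall k, Rabs (u t k - u t0 k) <= eps) /\
  (forall k, u 0 k = u0 k) /\
  (forall k : Z, forall t, 0 < t ->
     0 < u t k /\
     is_derive (fun s => u s k) t (Delta (fun j => G beta (u t j)) k) /\
     continuous (fun s => Derive (fun r => u r k) s) t).

(* t^a with the convention 0^a = 0 (used for a > 0) *)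
Definition powt (t a : R) : R := if Rlt_dec 0 t then Rpower t a else 0.

Definition besselI (L : nat) (s : R) : R :=
  / PI * RInt (fun th => exp (s * cos th) * cos (INR L * th)) 0 PI.

(* Main.v *)
From Stdlib Require Import Reals ZArith Lra Lia.
From Coquelicot Require Import Coquelicot.
Require Import Defs.
Open Scope R_scope.

(** Lift the datum to [u0 + e] with [e > 0]: above [e] the nonlinearity [G] is increasing and
    Lipschitz, so the equation is solved by a monotone Picard iteration, and a comparison
    principle holds.  The lifted solutions decrease as [e] tends to [0].  A sub-solution that
    depends on space only through the distance to the next site where [u0 >= d], and on time
    through [t ^ (1 / (1 - beta))] (for [beta = 1], through [exp (-2 t) t^n / n!]), bounds them from
    below independently of [e]; this keeps the limit away from the singularity of [G] for
    [t > 0], and bounds its speed by an integrable function of [t].  For [beta = 1] the bound by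
    [exp (-2 t) I_L (2 t)] follows since [|I_L s| <= exp s * min (1, s^L)]. *)

(** * Real functions *)

(** Two obstacles shape the argument. The datum may vanish on runs of sites, where [G] is not
    Lipschitz for [0 < beta < 1] and unbounded for [beta < 0]; only bounds that are uniform in [e]
    survive the limit. And a function on the integers need not attain its infimum, so no minimum
    principle can be read off at an extremal site: every comparison is a scalar barrier argument at
    one fixed site, fed by a bound that is uniform over the others. The lower bound has a simple
    mechanism. For a short time a site with [u0 >= d] retains a definite fraction of [d], and each
    empty site is fed by its right neighbour, along a chain of length at most [L]. Once this time is
    over the bound is frozen, because constants solve the equation. The passage to the limit is
    carried out once, for an abstract lower bound [ell] and an abstract modulus [om] in time; the
    cases [beta < 1] and [beta = 1] differ only in the choice of these functions. *)

Lemma continuous_of_is_derive (f : R -> R) x l : is_derive f x l -> continuous f x.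
Proof. intros H. apply (ex_derive_continuous f). now exists l. Qed.

Lemma continuous_R (f : R -> R) x :
  continuous f x <-> forall eps, 0 < eps ->
    exists del, 0 < del /\ forall y, Rabs (y - x) < del -> Rabs (f y - f x) < eps.
Proof.
  split.
  - intros H eps He.
    destruct (proj1 (filterlim_locally f (f x)) H (mkposreal eps He)) as [del Hd].
    exists del. split; [apply cond_pos|]. intros y Hy. apply (Hd y Hy).
  - intros H. apply (filterlim_locally f (f x)). intros eps.
    destruct (H eps (cond_pos eps)) as [del [Hd Hy]].
    exists (mkposreal del Hd). intros y By. apply (Hy y By).
Qed.

Lemma exp_mono x y : x <= y -> exp x <= exp y.
Proof. intros [H|H]; [now apply Rlt_le, exp_increasing|subst; lra]. Qed.

Lemma MVT_open (f df : R -> R) a b :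
  a < b ->
  (forall x, a < x < b -> is_derive f x (df x)) ->
  (forall x, a <= x <= b -> continuous f x) ->
  exists c, a < c < b /\ f b - f a = df c * (b - a).
Proof.
  intros Hab Hd Hc.
  (* [MVT_gen] only yields a point of the closed interval. Off the open interval the derivative is
     declared to be the mean slope plus one, which no endpoint can satisfy. *)
  set (df' := fun x => if Rlt_dec a x then if Rlt_dec x b then df x
                       else (f b - f a) / (b - a) + 1 else (f b - f a) / (b - a) + 1).
  destruct (MVT_gen f a b df') as [c [H1 H2]].
  - rewrite Rmin_left, Rmax_right by lra. intros x Hx. unfold df'.
    destruct (Rlt_dec a x); [|lra]. destruct (Rlt_dec x b); [|lra]. auto.
  - rewrite Rmin_left, Rmax_right by lra. intros x Hx.
    apply continuity_pt_filterlim. now apply Hc.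
  - assert (K : ((f b - f a) / (b - a) + 1) * (b - a) = f b - f a + (b - a)) by (field; lra).
    unfold df' in H2. destruct (Rlt_dec a c); [|lra]. destruct (Rlt_dec c b); [|lra].
    exists c. split; [lra|exact H2].
Qed.

(* A minimum principle: look at the last time before [t] at which [h] is nonnegative. *)
Lemma barrier (h dh : R -> R) t0 t1 :
  0 <= h t0 ->
  (forall t, t0 <= t <= t1 -> continuous h t) ->
  (forall t, t0 < t < t1 -> is_derive h t (dh t)) ->
  (forall t, t0 < t < t1 -> h t < 0 -> 0 <= dh t) ->
  forall t, t0 <= t <= t1 -> 0 <= h t.
Proof.
  intros H0 Hc Hd Hs t Ht.
  destruct (Rle_lt_dec 0 (h t)) as [|Hneg]; [easy|exfalso].
  set (E := fun s => t0 <= s <= t /\ 0 <= h s).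
  destruct (completeness E) as [s0 [Hub Hlub]].
  { exists t. intros s [Hs1 _]. lra. }
  { exists t0. split; [lra|easy]. }
  assert (A1 : t0 <= s0) by (apply Hub; split; [lra|easy]).
  assert (A2 : s0 <= t) by (apply Hlub; intros s [Hs1 _]; lra).
  assert (A3 : 0 <= h s0).
  { destruct (Rle_lt_dec 0 (h s0)) as [|Hn]; [easy|exfalso].
    destruct (proj1 (continuous_R h s0) (Hc s0 ltac:(lra)) (- h s0) ltac:(lra)) as [del [Hdel Hy]].
    assert (s0 <= s0 - del); [|lra].
    apply Hlub. intros s [Hs1 Hs2]. assert (s <= s0) by (apply Hub; split; auto).
    destruct (Rle_lt_dec s (s0 - del)) as [|Hlt]; [easy|exfalso].
    assert (Hb : Rabs (s - s0) < del) by (apply Rabs_def1; lra).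
    apply Hy in Hb. apply Rabs_def2 in Hb. lra. }
  assert (A4 : s0 < t).
  { destruct A2 as [|A2]; [easy|]. subst s0. lra. }
  destruct (MVT_open h dh s0 t A4) as [c [Hc1 Hc2]].
  - intros x Hx. apply Hd. lra.
  - intros x Hx. apply Hc. lra.
  - assert (h c < 0).
    { destruct (Rle_lt_dec 0 (h c)) as [Hp|]; [|easy].
      assert (c <= s0) by (apply Hub; split; [lra|easy]). lra. }
    assert (0 <= dh c) by (apply Hs; [lra|easy]).
    assert (0 <= dh c * (t - s0)) by (apply Rmult_le_pos; lra). lra.
Qed.

(** Both [om + f] and [om - f] are nondecreasing. A modulus [om] replaces a Lipschitz constant
    because the speed of the solutions may blow up at time 0 while remaining integrable. *)
Lemma increment_bound (f df om dom : R -> R) a :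
  (forall t, a <= t -> continuous f t) ->
  (forall t, a < t -> is_derive f t (df t)) ->
  (forall t, a <= t -> continuous om t) ->
  (forall t, a < t -> is_derive om t (dom t)) ->
  (forall t, a < t -> Rabs (df t) <= dom t) ->
  forall s t, a <= s -> a <= t -> Rabs (f t - f s) <= Rabs (om t - om s).
Proof.
  intros Cf Df Co Do B.
  assert (K : forall s t, a <= s -> s < t -> Rabs (f t - f s) <= om t - om s).
  { intros s t Hs Hst.
    assert (Q : forall e, Rabs e = 1 -> 0 <= om t - om s + e * (f t - f s)).
    { intros e He.
      destruct (MVT_open (fun x => om x + e * f x) (fun x => dom x + e * df x) s t Hst)
        as [c [Hc Hc2]].
      - intros x Hx. apply (is_derive_plus (V:=R_NormedModule)); [apply Do; lra|].
        apply is_derive_scal. apply Df; lra.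
      - intros x Hx. apply (continuous_plus (V:=R_NormedModule)); [apply Co; lra|].
        apply (continuous_mult (fun _ => e) f); [apply continuous_const|apply Cf; lra].
      - assert (0 <= dom c + e * df c).
        { assert (Bc := B c ltac:(lra)).
          assert (- (e * df c) <= Rabs (df c)).
          { apply Rle_trans with (Rabs (- (e * df c))); [apply Rle_abs|].
            rewrite Rabs_Ropp, Rabs_mult, He. lra. }
          lra. }
        assert (0 <= (dom c + e * df c) * (t - s)) by (apply Rmult_le_pos; lra).
        lra. }
    assert (Q1 := Q 1 Rabs_R1).
    assert (Q2 := Q (-1) ltac:(rewrite Rabs_left; lra)).
    apply Rabs_le. lra. }
  intros s t Hs Ht. destruct (Rtotal_order s t) as [H|[H|H]].
  - apply Rle_trans with (om t - om s); [now apply K|apply Rle_abs].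
  - subst. rewrite !Rminus_diag, Rabs_R0. lra.
  - rewrite (Rabs_minus_sym (f t)), (Rabs_minus_sym (om t)).
    apply Rle_trans with (om s - om t); [now apply K|apply Rle_abs].
Qed.

Lemma lipschitz_of_derive_bound (f df : R -> R) K a :
  (forall t, a <= t -> continuous f t) ->
  (forall t, a < t -> is_derive f t (df t)) ->
  (forall t, a < t -> Rabs (df t) <= K) ->
  forall s t, a <= s -> a <= t -> Rabs (f t - f s) <= K * Rabs (t - s).
Proof.
  intros Cf Df B s t Hs Ht.
  assert (HK : 0 <= K).
  { apply Rle_trans with (2 := B (a + 1) ltac:(lra)). apply Rabs_pos. }
  replace (K * Rabs (t - s)) with (Rabs (K * t - K * s)).
  2: { rewrite <- Rmult_minus_distr_l, Rabs_mult, (Rabs_pos_eq K); easy. }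
  apply (increment_bound f df (fun x => K * x) (fun _ => K) a); auto.
  - intros x _. apply continuous_of_is_derive with K. auto_derive; [easy|ring].
  - intros x _. auto_derive; [easy|ring].
Qed.

(* The mean value theorem turns [y_n' = f_n] with [f_n] equi-Lipschitz into
   [|y_n x - y_n t - (x - t) f_n t| <= K |x - t|^2], which survives pointwise limits. *)
Lemma is_derive_pointwise_limit (y f : nat -> R -> R) (yl fl : R -> R) a K :
  (forall n t, a < t -> is_derive (y n) t (f n t)) ->
  (forall n s t, a < s -> a < t -> Rabs (f n t - f n s) <= K * Rabs (t - s)) ->
  (forall t, a < t -> is_lim_seq (fun n => y n t) (yl t)) ->
  (forall t, a < t -> is_lim_seq (fun n => f n t) (fl t)) ->
  forall t, a < t -> is_derive yl t (fl t).
Proof.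
  intros Dy Lf Ly Lfl t Ht.
  assert (HK : 0 <= K).
  { assert (Q := Lf O (a + 1) (a + 2) ltac:(lra) ltac:(lra)).
    replace (a + 2 - (a + 1)) with 1 in Q by ring. rewrite Rabs_R1 in Q.
    apply Rle_trans with (1 := Rabs_pos _) in Q. lra. }
  assert (Q : forall n x, a < x -> Rabs (y n x - y n t - (x - t) * f n t) <= K * (Rabs (x - t) * Rabs (x - t))).
  { intros n x Hx.
    assert (Cy : forall z, a < z -> continuous (y n) z)
      by (intros z Hz; eapply continuous_of_is_derive; apply Dy, Hz).
    assert (P : exists c, a < c /\ Rabs (c - t) <= Rabs (x - t) /\ y n x - y n t = f n c * (x - t)).
    { destruct (Rtotal_order x t) as [H|[H|H]].
      - destruct (MVT_open (y n) (f n) x t H) as [c [H1 H2]].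
        + intros z Hz; apply Dy; lra.
        + intros z Hz; apply Cy; lra.
        + exists c. repeat split; [lra| |lra]. rewrite !Rabs_left; lra.
      - exists t. subst. rewrite !Rminus_diag, Rabs_R0. repeat split; lra.
      - destruct (MVT_open (y n) (f n) t x H) as [c [H1 H2]].
        + intros z Hz; apply Dy; lra.
        + intros z Hz; apply Cy; lra.
        + exists c. repeat split; [lra| |lra]. rewrite !Rabs_right; lra. }
    destruct P as [c [Hc1 [Hc2 Hc3]]].
    replace (y n x - y n t - (x - t) * f n t) with ((f n c - f n t) * (x - t)) by (rewrite Hc3; ring).
    rewrite Rabs_mult, <- Rmult_assoc. apply Rmult_le_compat_r; [apply Rabs_pos|].
    apply Rle_trans with (K * Rabs (c - t)); [apply Lf; lra|].
    apply Rmult_le_compat_l; lra. }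
  assert (Q' : forall x, a < x -> Rabs (yl x - yl t - (x - t) * fl t) <= K * (Rabs (x - t) * Rabs (x - t))).
  { intros x Hx.
    apply (is_lim_seq_le (fun n => Rabs (y n x - y n t - (x - t) * f n t))
             (fun _ => K * (Rabs (x - t) * Rabs (x - t)))
             (Rabs (yl x - yl t - (x - t) * fl t)) (K * (Rabs (x - t) * Rabs (x - t)))).
    - intros n. now apply Q.
    - apply (is_lim_seq_abs _ (Finite _)).
      apply is_lim_seq_minus'; [apply is_lim_seq_minus'; auto|].
      apply (is_lim_seq_scal_l _ (x - t) (Finite (fl t))). auto.
    - apply is_lim_seq_const. }
  apply is_derive_Reals. intros eps He.
  assert (Hm : 0 < Rmin (t - a) (eps / (K + 1))).
  { apply Rmin_glb_lt; [lra|]. apply Rdiv_lt_0_compat; lra. }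
  exists (mkposreal _ Hm). intros h Hh Hh2. simpl in Hh2.
  assert (H1 : Rabs h < t - a) by (eapply Rlt_le_trans; [exact Hh2|apply Rmin_l]).
  assert (H2 : Rabs h < eps / (K + 1)) by (eapply Rlt_le_trans; [exact Hh2|apply Rmin_r]).
  assert (H3 : a < t + h) by (apply Rabs_def2 in H1; lra).
  assert (Q2 := Q' (t + h) H3). replace (t + h - t) with h in Q2 by ring.
  assert (Hp : 0 < Rabs h) by now apply Rabs_pos_lt.
  replace ((yl (t + h) - yl t) / h - fl t) with ((yl (t + h) - yl t - h * fl t) / h) by (field; easy).
  unfold Rdiv. rewrite Rabs_mult, Rabs_inv.
  apply Rmult_lt_reg_r with (Rabs h); [easy|].
  rewrite Rmult_assoc, Rinv_l, Rmult_1_r by lra.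
  apply Rle_lt_trans with (1 := Q2). rewrite <- Rmult_assoc. apply Rmult_lt_compat_r; [easy|].
  apply Rle_lt_trans with (K * (eps / (K + 1))).
  - apply Rmult_le_compat_l; lra.
  - apply Rmult_lt_reg_r with (K + 1); [lra|].
    replace (K * (eps / (K + 1)) * (K + 1)) with (K * eps) by (field; lra). nra.
Qed.

(** * The lattice equation with an increasing Lipschitz nonlinearity *)

(** Variation of constants, the form in which each Picard iterate is written. *)
Lemma is_derive_duhamel (phi : R -> R) c y0 :
  (forall t, continuous phi t) ->
  forall t, is_derive (fun s => exp (- c * s) * (y0 + RInt (fun r => exp (c * r) * phi r) 0 s)) t
    (phi t - c * (exp (- c * t) * (y0 + RInt (fun r => exp (c * r) * phi r) 0 t))).
Proof.
  intros Cp t.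
  assert (Ce : forall x, continuous (fun r => exp (c * r) * phi r) x).
  { intros x. apply (continuous_mult (fun r => exp (c * r)) phi); [|apply Cp].
    apply continuous_of_is_derive with (c * exp (c * x)). auto_derive; [easy|ring]. }
  assert (DI : is_derive (fun s => RInt (fun r => exp (c * r) * phi r) 0 s) t (exp (c * t) * phi t)).
  { apply (is_derive_RInt (fun r => exp (c * r) * phi r) _ 0 t); [|apply Ce].
    exists (mkposreal 1 Rlt_0_1). intros b _. apply (RInt_correct (V:=R_CompleteNormedModule)).
    apply (ex_RInt_continuous (V:=R_CompleteNormedModule)). intros; apply Ce. }
  assert (D1 : is_derive (fun s => exp (- c * s)) t (- c * exp (- c * t))).
  { auto_derive; [easy|ring]. }
  assert (D2 : is_derive (fun s => y0 + RInt (fun r => exp (c * r) * phi r) 0 s) t (0 + exp (c * t) * phi t)).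
  { apply (is_derive_plus (V:=R_NormedModule)); [|exact DI].
    apply (is_derive_const (V:=R_NormedModule)). }
  assert (D := is_derive_mult _ _ t _ _ D1 D2 (fun n m => Rmult_comm n m)).
  apply (eq_rect _ (is_derive (fun s => exp (- c * s) * (y0 + RInt (fun r => exp (c * r) * phi r) 0 s)) t) D).
  unfold plus, mult; simpl.
  assert (E : exp (- c * t) * exp (c * t) = 1) by (rewrite <- exp_plus, <- exp_0; f_equal; ring).
  transitivity (exp (- c * t) * exp (c * t) * phi t
      - c * (exp (- c * t) * (y0 + RInt (fun r => exp (c * r) * phi r) 0 t))); [ring|rewrite E; ring].
Qed.

Section Picard.

Variables (g : R -> R) (La a b : R) (u0 : Z -> R).
Hypothesis La_ge0 : 0 <= La.
Hypothesis g_mono : forall x y, x <= y -> g x <= g y.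
Hypothesis g_lip : forall x y, x <= y -> g y - g x <= La * (y - x).
Hypothesis u0_bd : forall k, a <= u0 k <= b.

(* The equation [u' = Delta (g u)] reads [u' + 2 La u = monotone_part u], and
   [monotone_part] is order preserving because [La] bounds the slope of [g]. *)
Definition monotone_part (u : Z -> R) (k : Z) : R :=
  g (u (k - 1)%Z) + g (u (k + 1)%Z) + 2 * (La * u k - g (u k)).

(** The iteration starts at the constant [a], which lies below the datum and is itself a stationary
    solution. The iterates therefore increase, and being bounded by [b] they converge pointwise
    without any contraction estimate. *)
Fixpoint picard (n : nat) (t : R) (k : Z) : R :=
  match n with
  | O => a
  | S m => exp (- (2 * La) * t) *
      (u0 k + RInt (fun s => exp (2 * La * s) * monotone_part (picard m s) k) 0 t)
  end.

Lemma g_lip_abs x y : Rabs (g x - g y) <= La * Rabs (x - y).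
Proof.
  destruct (Rle_dec x y) as [H|H].
  - rewrite !Rabs_left1; [|lra|apply Rle_minus; now apply g_mono].
    generalize (g_lip x y H). lra.
  - rewrite !Rabs_right; [|lra|apply Rge_minus, Rle_ge; apply g_mono; lra].
    apply g_lip; lra.
Qed.

Lemma g_continuous x : continuous g x.
Proof.
  apply continuous_R. intros eps He. exists (eps / (La + 1)).
  split; [apply Rdiv_lt_0_compat; lra|]. intros y Hy.
  apply Rle_lt_trans with (1 := g_lip_abs y x).
  apply Rle_lt_trans with (La * (eps / (La + 1))); [apply Rmult_le_compat_l; lra|].
  apply Rmult_lt_reg_r with (La + 1); [lra|].
  replace (La * (eps / (La + 1)) * (La + 1)) with (La * eps) by (field; lra). nra.
Qed.

Lemma monotone_part_mono u v k : (forall j, u j <= v j) -> monotone_part u k <= monotone_part v k.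
Proof.
  intros H. unfold monotone_part.
  generalize (g_mono _ _ (H (k - 1)%Z)) (g_mono _ _ (H (k + 1)%Z)) (g_lip _ _ (H k)). lra.
Qed.

Lemma monotone_part_const c k : monotone_part (fun _ => c) k = 2 * La * c.
Proof. unfold monotone_part. ring. Qed.

Lemma monotone_part_lip u v k D : (forall j, Rabs (u j - v j) <= D) ->
  Rabs (monotone_part u k - monotone_part v k) <= 6 * La * D.
Proof.
  intros H.
  assert (Q : forall j, Rabs (g (u j) - g (v j)) <= La * D).
  { intros j. apply Rle_trans with (1 := g_lip_abs _ _). now apply Rmult_le_compat_l. }
  assert (P : La * Rabs (u k - v k) <= La * D) by now apply Rmult_le_compat_l.
  rewrite <- (Rabs_pos_eq La La_ge0), <- Rabs_mult, (Rabs_pos_eq La La_ge0) in P.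
  assert (Q1 := Q (k - 1)%Z). assert (Q2 := Q (k + 1)%Z). assert (Q3 := Q k).
  apply Rabs_le_between in Q1, Q2, Q3, P. unfold monotone_part. apply Rabs_le. lra.
Qed.

Lemma monotone_part_continuous (u : R -> Z -> R) k t :
  (forall j, continuous (fun s => u s j) t) -> continuous (fun s => monotone_part (u s) k) t.
Proof.
  intros H.
  assert (Q : forall j, continuous (fun s => g (u s j)) t).
  { intros j. apply (continuous_comp (fun s => u s j) g); [apply H|apply g_continuous]. }
  unfold monotone_part.
  apply (continuous_plus (V:=R_NormedModule)); [apply (continuous_plus (V:=R_NormedModule)); apply Q|].
  apply (continuous_mult (fun _ => 2)); [apply continuous_const|].
  apply (continuous_minus (V:=R_NormedModule)); [|apply Q].
  apply (continuous_mult (fun _ => La)); [apply continuous_const|apply H].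
Qed.

Lemma picard_continuous n k t : continuous (fun s => picard n s k) t.
Proof.
  revert k t. induction n as [|n IH]; intros k t; [apply continuous_const|].
  eapply continuous_of_is_derive. simpl.
  apply (is_derive_duhamel (fun s => monotone_part (picard n s) k) (2 * La) (u0 k)).
  intros s. apply monotone_part_continuous. auto.
Qed.

Lemma picard_derive n k t :
  is_derive (fun s => picard (S n) s k) t (monotone_part (picard n t) k - 2 * La * picard (S n) t k).
Proof.
  simpl. apply (is_derive_duhamel (fun s => monotone_part (picard n s) k) (2 * La) (u0 k)).
  intros s. apply monotone_part_continuous. intros; apply picard_continuous.
Qed.

Lemma picard_0 n k : picard (S n) 0 k = u0 k.
Proof. simpl. rewrite Rmult_0_r, exp_0, RInt_point. unfold zero; simpl. ring. Qed.

(** By [monotone_part_const] the constants [a] and [b] are fixed by the iteration, up to the initial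
    value. An iterate below [a] is thus pushed up, and one above [b] is pushed down. *)
Lemma picard_bounds n k t : 0 <= t -> a <= picard n t k <= b.
Proof.
  assert (Hab : a <= b) by (generalize (u0_bd 0%Z); lra).
  revert k t. induction n as [|n IH]; intros k t Ht; [simpl; lra|].
  assert (B : forall s, 0 <= s -> 2 * La * a <= monotone_part (picard n s) k <= 2 * La * b).
  { intros s Hs. rewrite <- (monotone_part_const a k), <- (monotone_part_const b k).
    split; apply monotone_part_mono; intros j; apply IH; easy. }
  split; apply Rminus_le_0.
  - apply (barrier (fun s => picard (S n) s k - a)
      (fun s => (monotone_part (picard n s) k - 2 * La * picard (S n) s k) - 0) 0 t); [..|lra].
    + rewrite picard_0. generalize (u0_bd k). lra.
    + intros s Hs. apply (continuous_minus (V:=R_NormedModule)); [apply picard_continuous|apply continuous_const].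
    + intros s Hs. apply (is_derive_minus (V:=R_NormedModule)); [apply picard_derive|apply (is_derive_const (V:=R_NormedModule))].
    + intros s Hs Hn. generalize (B s ltac:(lra)).
      assert (La * picard (S n) s k <= La * a) by (apply Rmult_le_compat_l; lra). lra.
  - apply (barrier (fun s => b - picard (S n) s k)
      (fun s => 0 - (monotone_part (picard n s) k - 2 * La * picard (S n) s k)) 0 t); [..|lra].
    + rewrite picard_0. generalize (u0_bd k). lra.
    + intros s Hs. apply (continuous_minus (V:=R_NormedModule)); [apply continuous_const|apply picard_continuous].
    + intros s Hs. apply (is_derive_minus (V:=R_NormedModule)); [apply (is_derive_const (V:=R_NormedModule))|apply picard_derive].
    + intros s Hs Hn. generalize (B s ltac:(lra)).
      assert (La * b <= La * picard (S n) s k) by (apply Rmult_le_compat_l; lra). lra.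
Qed.

Lemma picard_incr n k t : 0 <= t -> picard n t k <= picard (S n) t k.
Proof.
  revert k t. induction n as [|n IH]; intros k t Ht; [now apply picard_bounds|].
  apply Rminus_le_0.
  apply (barrier (fun s => picard (S (S n)) s k - picard (S n) s k)
    (fun s => (monotone_part (picard (S n) s) k - 2 * La * picard (S (S n)) s k) -
      (monotone_part (picard n s) k - 2 * La * picard (S n) s k)) 0 t); [..|lra].
  - rewrite !picard_0. lra.
  - intros s Hs. apply (continuous_minus (V:=R_NormedModule)); apply picard_continuous.
  - intros s Hs. apply (is_derive_minus (V:=R_NormedModule)); apply picard_derive.
  - intros s Hs Hn.
    assert (monotone_part (picard n s) k <= monotone_part (picard (S n) s) k).
    { apply monotone_part_mono. intros; apply IH; lra. }
    assert (0 <= La * (picard (S n) s k - picard (S (S n)) s k)) by (apply Rmult_le_pos; lra).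
    lra.
Qed.

Lemma picard_lip n k s t : 0 <= s -> 0 <= t ->
  Rabs (picard n t k - picard n s k) <= 2 * La * (b - a) * Rabs (t - s).
Proof.
  assert (Hab : a <= b) by (generalize (u0_bd 0%Z); lra).
  destruct n as [|n].
  - intros _ _. simpl. rewrite Rminus_diag, Rabs_R0.
    repeat apply Rmult_le_pos; try apply Rabs_pos; lra.
  - apply (lipschitz_of_derive_bound (fun t => picard (S n) t k)
      (fun s => monotone_part (picard n s) k - 2 * La * picard (S n) s k)).
    + intros; apply picard_continuous.
    + intros; apply picard_derive.
    + intros r Hr.
      assert (B : 2 * La * a <= monotone_part (picard n r) k <= 2 * La * b).
      { rewrite <- (monotone_part_const a k), <- (monotone_part_const b k).
        split; apply monotone_part_mono; intros j; apply picard_bounds; lra. }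
      assert (0 <= La * (picard (S n) r k - a)) by (apply Rmult_le_pos; [|generalize (picard_bounds (S n) k r)]; lra).
      assert (0 <= La * (b - picard (S n) r k)) by (apply Rmult_le_pos; [|generalize (picard_bounds (S n) k r)]; lra).
      apply Rabs_le. lra.
Qed.

(** Negative times are sent to 0, so that the function is constant there. Bounds and Lipschitz
    estimate then hold on the whole line, and the two-sided notion [continuous] applies at time
    0. *)
Definition picard_limit (t : R) (k : Z) : R := real (Lim_seq (fun n => picard n (Rmax 0 t) k)).

Lemma picard_limit_correct k t : is_lim_seq (fun n => picard n (Rmax 0 t) k) (picard_limit t k).
Proof.
  apply Lim_seq_correct'. apply ex_finite_lim_seq_incr with b.
  - intros n. apply picard_incr. apply Rmax_l.
  - intros n. apply picard_bounds. apply Rmax_l.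
Qed.

Lemma picard_limit_0 k : picard_limit 0 k = u0 k.
Proof.
  assert (H := picard_limit_correct k 0). rewrite Rmax_left in H by lra.
  apply is_lim_seq_incr_1 in H.
  assert (H' : is_lim_seq (fun n => picard (S n) 0 k) (u0 k)).
  { apply (is_lim_seq_ext (fun _ => u0 k)); [intros n; now rewrite picard_0|apply is_lim_seq_const]. }
  apply is_lim_seq_unique in H, H'. congruence.
Qed.

Lemma picard_limit_bounds k t : a <= picard_limit t k <= b.
Proof.
  split.
  - apply (is_lim_seq_le (fun _ => a) (fun n => picard n (Rmax 0 t) k) a (picard_limit t k)).
    + intros n. apply picard_bounds, Rmax_l.
    + apply is_lim_seq_const.
    + apply picard_limit_correct.
  - apply (is_lim_seq_le (fun n => picard n (Rmax 0 t) k) (fun _ => b) (picard_limit t k) b).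
    + intros n. apply picard_bounds, Rmax_l.
    + apply picard_limit_correct.
    + apply is_lim_seq_const.
Qed.

Lemma picard_limit_lip k s t :
  Rabs (picard_limit t k - picard_limit s k) <= 2 * La * (b - a) * Rabs (t - s).
Proof.
  assert (Hab : a <= b) by (generalize (u0_bd 0%Z); lra).
  apply (is_lim_seq_le (fun n => Rabs (picard n (Rmax 0 t) k - picard n (Rmax 0 s) k))
    (fun _ => 2 * La * (b - a) * Rabs (t - s))
    (Rabs (picard_limit t k - picard_limit s k)) (2 * La * (b - a) * Rabs (t - s))).
  - intros n. apply Rle_trans with (1 := picard_lip n k _ _ (Rmax_l _ _) (Rmax_l _ _)).
    apply Rmult_le_compat_l; [repeat apply Rmult_le_pos; lra|].
    unfold Rmax. destruct (Rle_dec 0 t), (Rle_dec 0 s); unfold Rabs; repeat destruct Rcase_abs; lra.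
  - apply (is_lim_seq_abs _ (Finite _)), is_lim_seq_minus'; apply picard_limit_correct.
  - apply is_lim_seq_const.
Qed.

Lemma picard_limit_derive k t : 0 < t ->
  is_derive (fun s => picard_limit s k) t (Delta (fun j => g (picard_limit t j)) k).
Proof.
  assert (L : forall j s, 0 < s -> is_lim_seq (fun n => picard n s j) (picard_limit s j)).
  { intros j s Hs. assert (H := picard_limit_correct j s). now rewrite Rmax_right in H by lra. }
  assert (Lg : forall j s, 0 < s -> is_lim_seq (fun n => g (picard n s j)) (g (picard_limit s j))).
  { intros j s Hs. apply is_lim_seq_continuous; [|now apply L].
    apply continuity_pt_filterlim, g_continuous. }
  apply (is_derive_pointwise_limit (fun n s => picard (S n) s k)
    (fun n s => monotone_part (picard n s) k - 2 * La * picard (S n) s k)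
    (fun s => picard_limit s k) (fun s => Delta (fun j => g (picard_limit s j)) k)
    (* The last factor is the Lipschitz constant in time of the iterates; [8 * La] adds [6 * La]
       from [monotone_part] and [2 * La] from the damping term. The sequence is shifted by one since
       only iterates from rank 1 on satisfy a differential equation. *)
    0 (8 * La * (2 * La * (b - a)))).
  - intros n s _. apply picard_derive.
  - intros n s r Hs Hr.
    assert (Q1 : Rabs (monotone_part (picard n r) k - monotone_part (picard n s) k)
      <= 6 * La * (2 * La * (b - a) * Rabs (r - s))).
    { apply monotone_part_lip. intros j. apply picard_lip; lra. }
    assert (Q2 := picard_lip (S n) k s r ltac:(lra) ltac:(lra)).
    apply (Rmult_le_compat_l La) in Q2; [|easy].
    replace (La * Rabs (picard (S n) r k - picard (S n) s k))
      with (Rabs (La * (picard (S n) r k - picard (S n) s k))) in Q2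
      by now rewrite Rabs_mult, (Rabs_pos_eq La).
    apply Rabs_le_between in Q1, Q2. apply Rabs_le. lra.
  - intros s Hs. apply (is_lim_seq_incr_1 (fun n => picard n s k)). now apply L.
  - intros s Hs. unfold Delta.
    replace (g (picard_limit s (k - 1)) - 2 * g (picard_limit s k) + g (picard_limit s (k + 1)))
      with (g (picard_limit s (k - 1)) + g (picard_limit s (k + 1)) +
        2 * (La * picard_limit s k - g (picard_limit s k)) - 2 * La * picard_limit s k) by ring.
    unfold monotone_part.
    apply is_lim_seq_minus'; [apply is_lim_seq_plus'; [apply is_lim_seq_plus'; now apply Lg|]|].
    + apply (is_lim_seq_scal_l _ 2 (Finite _)). apply is_lim_seq_minus'; [|now apply Lg].
      apply (is_lim_seq_scal_l _ La (Finite _)). now apply L.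
    + apply (is_lim_seq_scal_l _ (2 * La) (Finite _)).
      apply (is_lim_seq_incr_1 (fun n => picard n s k)). now apply L.
Qed.

End Picard.

(** * Comparison principle and lifted solutions *)

Lemma Rabs_sign_mult x : x <> 0 -> x / Rabs x * x = Rabs x.
Proof.
  intros H. unfold Rabs. destruct (Rcase_abs x); field; lra.
Qed.

(** The prefactor [beta / Rabs beta] corrects the sign of the derivative of the power, so [G]
    increases on positive arguments for either sign of [beta]. *)
Lemma G_is_derive beta x : beta <> 0 -> 0 < x ->
  is_derive (G beta) x (Rabs beta * Rpower x (beta - 1)).
Proof.
  intros Hb Hx. rewrite <- (Rabs_sign_mult beta Hb), Rmult_assoc. unfold G.
  apply is_derive_scal. apply is_derive_Reals. now apply derivable_pt_lim_power.
Qed.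

Lemma Rpower_pos x y : 0 < Rpower x y.
Proof. apply exp_pos. Qed.

Lemma Rpower_le_antitone x y z : z <= 0 -> 0 < x <= y -> Rpower y z <= Rpower x z.
Proof.
  intros Hz [Hx Hxy]. unfold Rpower.
  assert (ln x <= ln y) by now apply ln_le.
  apply exp_mono. nra.
Qed.

Section Nonlinearity.

Variable beta : R.
Hypothesis beta_neq0 : beta <> 0.
Hypothesis beta_le1 : beta <= 1.

Lemma G_continuous x : 0 < x -> continuous (G beta) x.
Proof. intros H. eapply continuous_of_is_derive. now apply G_is_derive. Qed.

Lemma G_increment x y : 0 < x <= y ->
  0 <= G beta y - G beta x <= Rabs beta * Rpower x (beta - 1) * (y - x).
Proof.
  intros [Hx [Hxy|Hxy]]; [|subst; lra].
  destruct (MVT_open (G beta) (fun z => Rabs beta * Rpower z (beta - 1)) x y Hxy) as [c [Hc E]].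
  - intros z Hz. apply G_is_derive; [easy|lra].
  - intros z Hz. apply G_continuous; lra.
  - rewrite E. assert (Hp := Rabs_pos beta). split.
    + apply Rmult_le_pos; [|lra]. apply Rmult_le_pos; [easy|]. apply Rlt_le, Rpower_pos.
    + apply Rmult_le_compat_r; [lra|]. apply Rmult_le_compat_l; [easy|].
      apply Rpower_le_antitone; lra.
Qed.

Lemma G_mono x y : 0 < x <= y -> G beta x <= G beta y.
Proof. intros H. generalize (G_increment x y H). lra. Qed.

(** The derivative of [G] at [e]. As [beta <= 1], the derivative decreases, so this is a Lipschitz
    constant on the half-line from [e] on. *)
Definition G_slope (e : R) : R := Rabs beta * Rpower e (beta - 1).

Lemma G_slope_ge0 e : 0 <= G_slope e.
Proof. apply Rmult_le_pos; [apply Rabs_pos|apply Rlt_le, Rpower_pos]. Qed.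

Lemma G_lip e x y : 0 < e -> e <= x -> x <= y -> G beta y - G beta x <= G_slope e * (y - x).
Proof.
  intros He Hx Hy. apply Rle_trans with (Rabs beta * Rpower x (beta - 1) * (y - x)).
  - apply G_increment; lra.
  - apply Rmult_le_compat_r; [lra|]. apply Rmult_le_compat_l; [apply Rabs_pos|].
    apply Rpower_le_antitone; lra.
Qed.

Lemma G_lip_abs e x y : 0 < e -> e <= x -> e <= y ->
  Rabs (G beta x - G beta y) <= G_slope e * Rabs (x - y).
Proof.
  intros He Hx Hy. destruct (Rle_dec x y) as [H|H].
  - rewrite !Rabs_left1; [|lra|apply Rle_minus, G_mono; lra].
    generalize (G_lip e x y He Hx H). lra.
  - rewrite !Rabs_right; [|lra|apply Rge_minus, Rle_ge, G_mono; lra].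
    apply G_lip; lra.
Qed.

Lemma Delta_dist (p q : Z -> R) k D :
  (forall j, Rabs (p j - q j) <= D) -> Rabs (Delta p k - Delta q k) <= 4 * D.
Proof.
  intros H. assert (H1 := H (k - 1)%Z). assert (H2 := H (k + 1)%Z). assert (H3 := H k).
  apply Rabs_le_between in H1, H2, H3. unfold Delta. apply Rabs_le. lra.
Qed.

Lemma Delta_bound (p : Z -> R) k D :
  (forall j, Rabs (p j) <= D) -> Rabs (Delta p k) <= 4 * D.
Proof.
  intros H. assert (H1 := H (k - 1)%Z). assert (H2 := H (k + 1)%Z). assert (H3 := H k).
  apply Rabs_le_between in H1, H2, H3. unfold Delta. apply Rabs_le. lra.
Qed.

(* The defect [w - v <= m exp (4 La t)] can be halved indefinitely: where [w > v], the
   off-diagonal terms of [Delta] only decrease [v - w] at rate [2 La m exp (4 La t)],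
   half the growth rate of the barrier.  Strict positivity of [w] suffices since [G] is only
   compared at points where [e <= v < w]. *)
Lemma comparison e t0 t1 (v w dv dw : R -> Z -> R) m :
  0 < e -> 0 <= t0 ->
  (forall k t, t0 <= t <= t1 -> continuous (fun s => v s k) t) ->
  (forall k t, t0 <= t <= t1 -> continuous (fun s => w s k) t) ->
  (forall k t, t0 < t < t1 -> is_derive (fun s => v s k) t (dv t k)) ->
  (forall k t, t0 < t < t1 -> is_derive (fun s => w s k) t (dw t k)) ->
  (forall k t, t0 < t < t1 -> Delta (fun j => G beta (v t j)) k <= dv t k) ->
  (forall k t, t0 < t < t1 -> dw t k <= Delta (fun j => G beta (w t j)) k) ->
  (forall k t, t0 < t < t1 -> e <= v t k) ->
  (forall k t, t0 < t < t1 -> 0 < w t k) ->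
  (forall k t, t0 <= t <= t1 -> w t k - v t k <= m) ->
  (forall k, w t0 k <= v t0 k) ->
  forall k t, t0 <= t <= t1 -> w t k <= v t k.
Proof.
  intros He Ht0 Cv Cw Dv Dw Sv Sw Pv Pw Hm H0.
  set (La := G_slope e). assert (HLa : 0 <= La) by apply G_slope_ge0.
  assert (Hm0 : 0 <= Rmax 0 m) by apply Rmax_l.
  assert (Half : forall n k t, t0 <= t <= t1 ->
    - (Rmax 0 m * (/ 2) ^ n * exp (4 * La * t)) <= v t k - w t k).
  { induction n as [|n IH]; intros k t Ht.
    - rewrite pow_O, Rmult_1_r.
      assert (1 <= exp (4 * La * t)).
      { rewrite <- exp_0. apply exp_mono, Rmult_le_pos; lra. }
      assert (Rmax 0 m * 1 <= Rmax 0 m * exp (4 * La * t)) by now apply Rmult_le_compat_l.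
      generalize (Hm k t Ht) (Rmax_r 0 m). lra.
    - set (c := Rmax 0 m * (/ 2) ^ S n).
      assert (Hc : Rmax 0 m * (/ 2) ^ n = 2 * c) by (unfold c; simpl; field).
      assert (Hc0 : 0 <= c) by (apply Rmult_le_pos; [easy|apply pow_le; lra]).
      assert (Q : 0 <= v t k - w t k + c * exp (4 * La * t)); [|lra].
      apply (barrier (fun s => v s k - w s k + c * exp (4 * La * s))
        (fun s => dv s k - dw s k + c * (4 * La * exp (4 * La * s))) t0 t1); [..|easy].
      + assert (0 <= c * exp (4 * La * t0)) by (apply Rmult_le_pos; [easy|apply Rlt_le, exp_pos]).
        generalize (H0 k). lra.
      + intros s Hs. apply (continuous_plus (V:=R_NormedModule)).
        * apply (continuous_minus (V:=R_NormedModule)); [now apply Cv|now apply Cw].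
        * eapply continuous_of_is_derive with (c * (4 * La * exp (4 * La * s))).
          auto_derive; [easy|ring].
      + intros s Hs. apply (is_derive_plus (V:=R_NormedModule)).
        * apply (is_derive_minus (V:=R_NormedModule)); [now apply Dv|now apply Dw].
        * auto_derive; [easy|ring].
      + intros s Hs Hneg. set (E := exp (4 * La * s)) in *.
        assert (HE : 0 < E) by apply exp_pos.
        assert (HcE : 0 <= c * E) by (apply Rmult_le_pos; lra).
        assert (Hk : G beta (v s k) <= G beta (w s k)).
        { apply G_mono. generalize (Pv k s Hs). lra. }
        assert (Hj : forall j, - (La * (2 * c * E)) <= G beta (v s j) - G beta (w s j)).
        { intros j. destruct (Rle_dec (w s j) (v s j)) as [Hle|Hle].
          - assert (G beta (w s j) <= G beta (v s j)) by (apply G_mono; split; [now apply Pw|easy]).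
            assert (0 <= La * (2 * c * E)) by (apply Rmult_le_pos; lra). lra.
          - assert (Q1 := G_lip e (v s j) (w s j) He (Pv j s Hs) ltac:(lra)). fold La in Q1.
            assert (Q2 := IH j s ltac:(lra)). rewrite Hc in Q2. fold E in Q2.
            assert (La * (w s j - v s j) <= La * (2 * c * E)) by (apply Rmult_le_compat_l; lra).
            lra. }
        assert (Q1 := Hj (k - 1)%Z). assert (Q2 := Hj (k + 1)%Z).
        assert (Q3 := Sv k s Hs). assert (Q4 := Sw k s Hs). unfold Delta in Q3, Q4.
        lra. }
  intros k t Ht. apply Rminus_le_0.
  apply (is_lim_seq_le (fun n => - (Rmax 0 m * (/ 2) ^ n * exp (4 * La * t))) (fun _ => v t k - w t k)
     0 (v t k - w t k)).
  - intros n. now apply Half.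
  - apply (is_lim_seq_ext (fun n => (- (Rmax 0 m * exp (4 * La * t))) * (/ 2) ^ n)); [intros n; ring|].
    replace (Finite 0) with (Rbar_mult (- (Rmax 0 m * exp (4 * La * t))) 0).
    + apply is_lim_seq_scal_l. apply is_lim_seq_geom. rewrite Rabs_right; lra.
    + simpl. f_equal. ring.
  - apply is_lim_seq_const.
Qed.

(* Lifting the datum by [e] keeps the solution away from the singularity of [G] at [0]. *)
Definition reg_solution (e : R) (u0 : Z -> R) (v : R -> Z -> R) : Prop :=
  (forall k, v 0 k = u0 k + e) /\
  (forall t k, e <= v t k) /\
  (exists M, forall t k, v t k <= M) /\
  (forall k t, continuous (fun s => v s k) t) /\
  (forall k t, 0 < t -> is_derive (fun s => v s k) t (Delta (fun j => G beta (v t j)) k)).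

(** Truncating the argument at [e] makes the nonlinearity globally monotone and Lipschitz, and
    avoids nonpositive arguments, where [Rpower] has the conventional value 1. Since the iterates
    stay above [e], the limit solves the equation with [G] itself. *)
Definition reg_sol (e : R) (u0 : Z -> R) : R -> Z -> R :=
  picard_limit (fun x => G beta (Rmax e x)) (G_slope e) e (fun k => u0 k + e).

Lemma reg_sol_correct e u0 : 0 < e -> linf_plus u0 -> reg_solution e u0 (reg_sol e u0).
Proof.
  intros He [Hu0 [M HM]].
  assert (Hm : forall x y, x <= y -> G beta (Rmax e x) <= G beta (Rmax e y)).
  { intros x y Hxy. apply G_mono. split; [apply Rlt_le_trans with e; [easy|apply Rmax_l]|].
    apply Rle_max_compat_l, Hxy. }
  assert (Hl : forall x y, x <= y -> G beta (Rmax e y) - G beta (Rmax e x) <= G_slope e * (y - x)).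
  { intros x y Hxy. apply Rle_trans with (G_slope e * (Rmax e y - Rmax e x)).
    - apply G_lip; [easy|apply Rmax_l|apply Rle_max_compat_l, Hxy].
    - apply Rmult_le_compat_l; [apply G_slope_ge0|].
      unfold Rmax. destruct (Rle_dec e y), (Rle_dec e x); lra. }
  assert (Hb : forall k, e <= u0 k + e <= M + e).
  { intros k. generalize (Hu0 k) (HM k) (Rle_abs (u0 k)). lra. }
  assert (Hs := G_slope_ge0 e).
  assert (B : forall t k, e <= reg_sol e u0 t k <= M + e).
  { intros t k. apply picard_limit_bounds; auto. }
  split; [|split; [|split; [|split]]].
  - intros k. eapply picard_limit_0; eauto.
  - apply B.
  - exists (M + e). apply B.
  - intros k t. apply continuous_R. intros eps Heps.
    set (K := 2 * G_slope e * (M + e - e)).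
    assert (HK : 0 <= K).
    { apply Rmult_le_pos; [lra|]. generalize (Hb 0%Z). lra. }
    exists (eps / (K + 1)). split; [apply Rdiv_lt_0_compat; lra|]. intros y Hy.
    apply Rle_lt_trans with (K * Rabs (y - t)); [apply picard_limit_lip; auto|].
    apply Rle_lt_trans with (K * (eps / (K + 1))); [apply Rmult_le_compat_l; lra|].
    apply Rmult_lt_reg_r with (K + 1); [lra|].
    replace (K * (eps / (K + 1)) * (K + 1)) with (K * eps) by (field; lra). nra.
  - intros k t Ht.
    assert (D := picard_limit_derive _ _ _ _ _ Hs Hm Hl Hb k t Ht).
    replace (Delta (fun j => G beta (reg_sol e u0 t j)) k)
      with (Delta (fun j => G beta (Rmax e (reg_sol e u0 t j))) k); [exact D|].
    unfold Delta. now rewrite !Rmax_right by apply B.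
Qed.

Section RegularizedSolutions.

Variables (e : R) (u0 : Z -> R) (v : R -> Z -> R).
Hypothesis e_gt0 : 0 < e.
Hypothesis v_sol : reg_solution e u0 v.

(** The a priori defect needed by [comparison] is the upper bound [m] of [w], because [v] is
    positive. The starting time is free so that the comparison can be restarted later from a bound
    already reached. *)
Lemma reg_solution_above (t0 t1 : R) (w dw : R -> Z -> R) m :
  0 <= t0 ->
  (forall k t, t0 <= t <= t1 -> continuous (fun s => w s k) t) ->
  (forall k t, t0 < t < t1 -> is_derive (fun s => w s k) t (dw t k)) ->
  (forall k t, t0 < t < t1 -> dw t k <= Delta (fun j => G beta (w t j)) k) ->
  (forall k t, t0 < t < t1 -> 0 < w t k) ->
  (forall k t, t0 <= t <= t1 -> w t k <= m) ->
  (forall k, w t0 k <= v t0 k) ->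
  forall k t, t0 <= t <= t1 -> w t k <= v t k.
Proof.
  intros Ht0 Cw Dw Sw Pw Hm H0. destruct v_sol as [_ [V1 [_ [V3 V4]]]].
  apply comparison with e (fun t k => Delta (fun j => G beta (v t j)) k) dw m; auto.
  - intros k t Ht. apply V4. lra.
  - intros k t Ht. lra.
  - intros k t Ht. generalize (V1 t k) (Hm k t Ht). lra.
Qed.

Lemma reg_solution_ge_const t0 c : 0 <= t0 -> 0 < c ->
  (forall k, c <= v t0 k) -> forall k t, t0 <= t -> c <= v t k.
Proof.
  intros Ht0 Hc H k t Ht.
  apply (reg_solution_above t0 t (fun _ _ => c) (fun _ _ => 0) c); auto; try lra.
  - intros; apply continuous_const.
  - intros; apply (is_derive_const (V:=R_NormedModule)).
  - intros; unfold Delta; lra.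
  - intros; lra.
Qed.

Lemma reg_solution_le_const c : (forall k, u0 k <= c) -> 0 <= c ->
  forall k t, 0 <= t -> v t k <= c + e.
Proof.
  intros H Hc k t Ht. destruct v_sol as [V0 [V1 [[M V2] [V3 V4]]]].
  apply (comparison e 0 t (fun _ _ => c + e) v (fun _ _ => 0)
    (fun t k => Delta (fun j => G beta (v t j)) k) M); auto; try lra.
  - intros; apply continuous_const.
  - intros; apply (is_derive_const (V:=R_NormedModule)).
  - intros j s Hs; apply V4; lra.
  - intros; unfold Delta; lra.
  - intros; lra.
  - intros; lra.
  - intros j s Hs. generalize (V1 s j). lra.
  - intros j s Hs. generalize (V2 s j). lra.
  - intros j. rewrite V0. generalize (H j). lra.
Qed.

End RegularizedSolutions.

Lemma reg_solution_mono e e' u0 v v' : 0 < e <= e' ->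
  reg_solution e u0 v -> reg_solution e' u0 v' -> forall k t, 0 <= t -> v t k <= v' t k.
Proof.
  intros [He Hee'] Hv Hv' k t Ht. destruct Hv as [V0 [V1 [[M V2] [V3 V4]]]].
  apply (reg_solution_above e' u0 v' ltac:(lra) Hv' 0 t v
    (fun t k => Delta (fun j => G beta (v t j)) k) M); auto; try lra.
  - intros j s Hs. apply V4. lra.
  - intros; lra.
  - intros j s Hs. generalize (V1 s j). lra.
  - intros j. destruct Hv' as [V0' _]. rewrite V0, V0'. lra.
Qed.

End Nonlinearity.

(** * Removing the lift *)

Section VanishingLift.

(** [ell] and [dom] bound the lifted solutions from below and their speed from above, uniformly in
    the lift and in the site. [dom] may be unbounded near 0, but its primitive [om] is continuous
    there; this yields continuity of the limit in the supremum norm down to time 0. *)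
Variables (beta : R) (u0 : Z -> R) (ell om dom : R -> R).
Hypothesis beta_neq0 : beta <> 0.
Hypothesis beta_le1 : beta <= 1.
Hypothesis u0_linf : linf_plus u0.
Hypothesis ell_gt0 : forall t, 0 < t -> 0 < ell t.
Hypothesis ell_mono : forall s t, 0 <= s <= t -> ell s <= ell t.
Hypothesis ell_lower : forall e v, 0 < e <= 1 -> reg_solution beta e u0 v ->
  forall k t, 0 <= t -> ell t <= v t k.
Hypothesis om_continuous : forall t, 0 <= t -> continuous om t.
Hypothesis om_derive : forall t, 0 < t -> is_derive om t (dom t).
Hypothesis dom_speed : forall e v, 0 < e <= 1 -> reg_solution beta e u0 v ->
  forall k t, 0 < t -> Rabs (Delta (fun j => G beta (v t j)) k) <= dom t.

Definition lift (n : nat) : R := / INR (S n).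

Lemma lift_bounds n : 0 < lift n <= 1.
Proof.
  assert (H : 1 <= INR (S n)) by (apply (le_INR 1); lia).
  split; [apply Rinv_0_lt_compat; lra|]. unfold lift. rewrite <- Rinv_1. apply Rinv_le_contravar; lra.
Qed.

Lemma lift_decr n : lift (S n) <= lift n.
Proof. apply Rinv_le_contravar; [apply lt_0_INR; lia|apply le_INR; lia]. Qed.

Lemma lift_lim : is_lim_seq lift 0.
Proof.
  apply (is_lim_seq_incr_1 (fun n => / INR n)).
  replace (Finite 0) with (Rbar_inv p_infty) by easy.
  apply is_lim_seq_inv; [apply is_lim_seq_INR|easy].
Qed.

Definition approx (n : nat) : R -> Z -> R := reg_sol beta (lift n) u0.

Lemma approx_sol n : reg_solution beta (lift n) u0 (approx n).
Proof. apply reg_sol_correct; auto. apply lift_bounds. Qed.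

Definition limit_sol (t : R) (k : Z) : R := real (Lim_seq (fun n => approx n t k)).

Lemma limit_sol_correct k t : 0 <= t -> is_lim_seq (fun n => approx n t k) (limit_sol t k).
Proof.
  intros Ht. apply Lim_seq_correct'. apply ex_finite_lim_seq_decr with 0.
  - intros n. apply (reg_solution_mono beta beta_neq0 beta_le1 (lift (S n)) (lift n) u0); auto using approx_sol.
    split; [apply lift_bounds|apply lift_decr].
  - intros n. destruct (approx_sol n) as [_ [V _]]. generalize (V t k) (lift_bounds n). lra.
Qed.

Lemma limit_sol_ge c k t : 0 <= t -> (forall n, c <= approx n t k) -> c <= limit_sol t k.
Proof.
  intros Ht H. apply (is_lim_seq_le (fun _ => c) (fun n => approx n t k) c (limit_sol t k)); auto.
  - apply is_lim_seq_const.
  - now apply limit_sol_correct.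
Qed.

Lemma limit_sol_le c k t : (forall j, u0 j <= c) -> 0 <= t -> limit_sol t k <= c.
Proof.
  intros Hc Ht.
  assert (Hc0 : 0 <= c) by (destruct u0_linf as [H _]; generalize (H 0%Z) (Hc 0%Z); lra).
  apply (is_lim_seq_le (fun n => approx n t k) (fun n => c + lift n) (limit_sol t k) c).
  - intros n. apply (reg_solution_le_const beta beta_neq0 beta_le1 (lift n) u0); auto using approx_sol.
    apply lift_bounds.
  - now apply limit_sol_correct.
  - replace (Finite c) with (Finite (c + 0)) by (f_equal; ring). apply is_lim_seq_plus'; [apply is_lim_seq_const|apply lift_lim].
Qed.

Lemma limit_sol_ge_datum c k t : (forall j, c <= u0 j) -> 0 <= t -> c <= limit_sol t k.
Proof.
  intros Hc Ht. apply limit_sol_ge; auto. intros n.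
  destruct (approx_sol n) as [V0 [V1 _]]. assert (Hl := lift_bounds n).
  (* Comparison with a constant asks for a positive one; a nonpositive [c] lies below any lifted
     solution anyway. *)
  destruct (Rle_lt_dec c 0) as [H|H]; [generalize (V1 t k); lra|].
  apply (reg_solution_ge_const beta beta_neq0 beta_le1 (lift n) u0 (approx n) ltac:(lra) (approx_sol n) 0); try lra.
  intros j. rewrite V0. generalize (Hc j). lra.
Qed.

Lemma limit_sol_ell k t : 0 <= t -> ell t <= limit_sol t k.
Proof.
  intros Ht. apply limit_sol_ge; auto. intros n.
  apply ell_lower with (lift n); auto using lift_bounds, approx_sol.
Qed.

Lemma limit_sol_gt0 k t : 0 < t -> 0 < limit_sol t k.
Proof. intros Ht. apply Rlt_le_trans with (ell t); [auto|apply limit_sol_ell; lra]. Qed.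

Lemma limit_sol_modulus k s t : 0 <= s -> 0 <= t ->
  Rabs (limit_sol t k - limit_sol s k) <= Rabs (om t - om s).
Proof.
  intros Hs Ht.
  apply (is_lim_seq_le (fun n => Rabs (approx n t k - approx n s k)) (fun _ => Rabs (om t - om s))
    (Rabs (limit_sol t k - limit_sol s k)) (Rabs (om t - om s))).
  - intros n. destruct (approx_sol n) as [V0 [V1 [V2 [V3 V4]]]].
    apply (increment_bound (fun t => approx n t k) (fun t => Delta (fun j => G beta (approx n t j)) k)
      om dom 0); auto.
    intros r Hr. apply dom_speed with (lift n); auto using lift_bounds, approx_sol.
  - apply (is_lim_seq_abs _ (Finite _)), is_lim_seq_minus'; now apply limit_sol_correct.
  - apply is_lim_seq_const.
Qed.

(** After time [t / 2] all lifted solutions lie between [ell (t / 2)] and [M + 1], an interval on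
    which [G] is bounded by [Gb] and Lipschitz. Their speeds are then equi-Lipschitz in time, which
    is what the pointwise limit of derivatives requires. *)
Lemma limit_sol_derive k t : 0 < t ->
  is_derive (fun s => limit_sol s k) t (Delta (fun j => G beta (limit_sol t j)) k).
Proof.
  intros Ht. set (a := t / 2). assert (Ha : 0 < a) by (unfold a; lra).
  destruct u0_linf as [Hu0 [M HM]].
  assert (HM0 : 0 <= M) by (generalize (HM 0%Z) (Rabs_pos (u0 0%Z)); lra).
  assert (La := ell_gt0 a Ha).
  assert (B : forall n s j, a <= s -> ell a <= approx n s j <= M + 1).
  { intros n s j Hs. assert (Hl := lift_bounds n). split.
    - apply Rle_trans with (ell s); [apply ell_mono; lra|].
      apply ell_lower with (lift n); auto using lift_bounds, approx_sol. lra.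
    - apply Rle_trans with (M + lift n); [|lra].
      apply (reg_solution_le_const beta beta_neq0 beta_le1 (lift n) u0); auto using approx_sol; try lra.
      intros i. apply Rle_trans with (2 := HM i). apply Rle_abs. }
  set (Gb := Rabs (G beta (ell a)) + Rabs (G beta (M + 1))).
  assert (HG : forall n s j, a <= s -> Rabs (G beta (approx n s j)) <= Gb).
  { intros n s j Hs. destruct (B n s j Hs) as [B1 B2].
    assert (Q1 : G beta (ell a) <= G beta (approx n s j)) by (apply G_mono; auto).
    assert (Q2 : G beta (approx n s j) <= G beta (M + 1)) by (apply G_mono; auto; lra).
    unfold Gb. generalize (Rle_abs (G beta (M + 1))) (Rabs_pos (G beta (M + 1)))
      (Rle_abs (- G beta (ell a))) (Rabs_pos (G beta (ell a))).
    rewrite Rabs_Ropp. intros. apply Rabs_le. lra. }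
  assert (VL : forall n s r j, a < s -> a < r ->
    Rabs (approx n r j - approx n s j) <= 4 * Gb * Rabs (r - s)).
  { intros n s r j Hs Hr. destruct (approx_sol n) as [V0 [V1 [V2 [V3 V4]]]].
    apply (lipschitz_of_derive_bound (fun t => approx n t j)
      (fun t => Delta (fun j => G beta (approx n t j)) j) (4 * Gb) a); auto; try lra.
    - intros z Hz. apply V4. lra.
    - intros z Hz. apply Delta_bound. intros i. apply HG. lra. }
  apply (is_derive_pointwise_limit (fun n s => approx n s k)
    (fun n s => Delta (fun j => G beta (approx n s j)) k) (fun s => limit_sol s k)
    (fun s => Delta (fun j => G beta (limit_sol s j)) k) a
    (4 * (G_slope beta (ell a) * (4 * Gb)))); [| | | |unfold a; lra].
  - intros n s Hs. destruct (approx_sol n) as [V0 [V1 [V2 [V3 V4]]]]. apply V4. lra.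
  - intros n s r Hs Hr. rewrite Rmult_assoc. apply Delta_dist. intros j.
    apply Rle_trans with (G_slope beta (ell a) * Rabs (approx n r j - approx n s j)).
    + apply G_lip_abs; auto; apply B; lra.
    + rewrite Rmult_assoc. apply Rmult_le_compat_l; [apply G_slope_ge0|now apply VL].
  - intros s Hs. apply limit_sol_correct. lra.
  - intros s Hs.
    assert (L : forall j, is_lim_seq (fun n => G beta (approx n s j)) (G beta (limit_sol s j))).
    { intros j. apply is_lim_seq_continuous; [|apply limit_sol_correct; lra].
      apply continuity_pt_filterlim. apply G_continuous; auto. apply limit_sol_gt0; lra. }
    unfold Delta. apply is_lim_seq_plus'; [apply is_lim_seq_minus'; auto|auto].
    apply (is_lim_seq_scal_l _ 2 (Finite _)). auto.
Qed.

Lemma limit_sol_is_solution : is_solution beta u0 limit_sol.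
Proof.
  destruct u0_linf as [Hu0 [M HM]].
  split; [|split; [|split]].
  - intros t Ht. assert (P : forall k, 0 <= limit_sol t k) by (intros; apply limit_sol_ge_datum; auto).
    split; auto. exists M. intros k. rewrite Rabs_pos_eq by auto. apply limit_sol_le; auto.
    intros j. apply Rle_trans with (2 := HM j). apply Rle_abs.
  - intros t0 Ht0 eps Heps.
    destruct (proj1 (continuous_R om t0) (om_continuous t0 Ht0) eps Heps) as [del [Hd H]].
    exists del. split; auto. intros t Ht Htt k.
    apply Rle_trans with (1 := limit_sol_modulus k t0 t Ht0 Ht). now apply Rlt_le, H.
  - intros k. assert (L := limit_sol_correct k 0 (Rle_refl 0)).
    assert (L' : is_lim_seq (fun n => approx n 0 k) (u0 k)).
    { apply (is_lim_seq_ext (fun n => u0 k + lift n)).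
      - intros n. symmetry. apply (approx_sol n).
      - replace (Finite (u0 k)) with (Finite (u0 k + 0)) by (f_equal; ring). apply is_lim_seq_plus'; [apply is_lim_seq_const|apply lift_lim]. }
    apply is_lim_seq_unique in L, L'. congruence.
  - intros k t Ht. split; [now apply limit_sol_gt0|split; [now apply limit_sol_derive|]].
    apply continuous_ext_loc with (fun s => Delta (fun j => G beta (limit_sol s j)) k).
    + exists (mkposreal t Ht). intros s Hs. symmetry. apply is_derive_unique, limit_sol_derive.
      change (Rabs (s - t) < t) in Hs. apply Rabs_def2 in Hs. lra.
    + assert (C : forall j, continuous (fun s => G beta (limit_sol s j)) t).
      { intros j. apply (continuous_comp (fun s => limit_sol s j) (G beta)).
        - eapply continuous_of_is_derive. now apply limit_sol_derive.
        - apply G_continuous; auto. now apply limit_sol_gt0. }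
      unfold Delta. apply (continuous_plus (V:=R_NormedModule)); auto.
      apply (continuous_minus (V:=R_NormedModule)); auto.
      apply (continuous_mult (fun _ => 2)); auto. apply continuous_const.
Qed.

Lemma exists_solution : exists u, is_solution beta u0 u /\
  (forall t k, 0 <= t -> ell t <= u t k) /\
  (forall c1 c2, (forall k, c1 <= u0 k <= c2) -> forall t k, 0 <= t -> c1 <= u t k <= c2).
Proof.
  exists limit_sol. split; [apply limit_sol_is_solution|split].
  - intros t k Ht. now apply limit_sol_ell.
  - intros c1 c2 H t k Ht. split; [apply limit_sol_ge_datum|apply limit_sol_le]; auto; apply H.
Qed.

End VanishingLift.

(** * Sub-solutions *)

Lemma P_Ld_window L d u0 : P_Ld L d u0 -> forall k, exists n, (n <= L)%nat /\ d <= u0 (k + Z.of_nat n)%Z.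
Proof.
  intros [_ H] k. specialize (H k).
  destruct (Classical_Prop.classic (exists n, (n <= L)%nat /\ d <= u0 (k + Z.of_nat n)%Z)) as [|Hn]; [easy|exfalso].
  unfold sigma_plus in H.
  set (E := fun x => exists l : Z, (k < l)%Z /\ d <= u0 l /\ x = IZR l) in H.
  destruct (Glb_Rbar_correct E) as [_ Hg].
  assert (B : is_lb_Rbar E (IZR (k + Z.of_nat L + 1))).
  { intros x [l [Hl1 [Hl2 Hx]]]. rewrite Hx. simpl. apply IZR_le.
    destruct (Z_le_gt_dec l (k + Z.of_nat L)) as [Hle|Hgt]; [|lia].
    exfalso. apply Hn. exists (Z.to_nat (l - k)). split; [lia|].
    replace (k + Z.of_nat (Z.to_nat (l - k)))%Z with l by lia. easy. }
  apply Hg in B. destruct (Glb_Rbar E) as [x| |]; simpl in B, H; try easy.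
  rewrite !plus_IZR, <- INR_IZR_INZ in B. lra.
Qed.

(* Distance from [k] to the next site to its right (or [k] itself) where [u0 >= d], searched
   up to distance [m]. *)
Fixpoint gap (d : R) (u0 : Z -> R) (m : nat) (k : Z) : nat :=
  match m with
  | O => O
  | S m' => if Rle_dec d (u0 k) then O else S (gap d u0 m' (k + 1))
  end.

Lemma gap_le d u0 m k : (gap d u0 m k <= m)%nat.
Proof.
  revert k. induction m as [|m IH]; intros k; simpl; [lia|].
  destruct (Rle_dec d (u0 k)); [lia|]. generalize (IH (k + 1)%Z). lia.
Qed.

Lemma gap_unique d u0 m k n : (n <= m)%nat -> d <= u0 (k + Z.of_nat n)%Z ->
  (forall i, (i < n)%nat -> u0 (k + Z.of_nat i)%Z < d) -> gap d u0 m k = n.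
Proof.
  revert k n. induction m as [|m IH]; intros k n Hn Hd Hi; simpl; [lia|].
  destruct (Rle_dec d (u0 k)) as [H|H].
  - destruct n as [|n]; [easy|]. specialize (Hi O ltac:(lia)).
    rewrite Z.add_0_r in Hi. lra.
  - destruct n as [|n]; [rewrite Z.add_0_r in Hd; easy|]. f_equal. apply IH; [lia| |].
    + replace (k + 1 + Z.of_nat n)%Z with (k + Z.of_nat (S n))%Z by lia. easy.
    + intros i Hin. replace (k + 1 + Z.of_nat i)%Z with (k + Z.of_nat (S i))%Z by lia. apply Hi. lia.
Qed.

(** An exhausted search returns its depth [m] without looking at the datum there; the existence of a
    site within reach makes this answer correct. *)
Lemma gap_spec d u0 m k : (exists n, (n <= m)%nat /\ d <= u0 (k + Z.of_nat n)%Z) ->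
  d <= u0 (k + Z.of_nat (gap d u0 m k))%Z /\
  (forall i, (i < gap d u0 m k)%nat -> u0 (k + Z.of_nat i)%Z < d).
Proof.
  revert k. induction m as [|m IH]; intros k [n [Hn Hd]]; simpl.
  - replace n with O in Hd by lia. split; [easy|lia].
  - destruct (Rle_dec d (u0 k)) as [H|H].
    + split; [now rewrite Z.add_0_r|lia].
    + destruct (IH (k + 1)%Z) as [I1 I2].
      * destruct n as [|n]; [rewrite Z.add_0_r in Hd; easy|]. exists n. split; [lia|].
        replace (k + 1 + Z.of_nat n)%Z with (k + Z.of_nat (S n))%Z by lia. easy.
      * split.
        -- replace (k + Z.of_nat (S (gap d u0 m (k + 1))))%Z
             with (k + 1 + Z.of_nat (gap d u0 m (k + 1)))%Z by lia. easy.
        -- intros [|i] Hi; [rewrite Z.add_0_r; lra|].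
           replace (k + Z.of_nat (S i))%Z with (k + 1 + Z.of_nat i)%Z by lia. apply I2. lia.
Qed.

Section Gap.

Variables (L : nat) (d : R) (u0 : Z -> R).
Hypothesis u0_P : P_Ld L d u0.

Lemma gap_0 k : gap d u0 L k = O -> d <= u0 k.
Proof.
  intros H. destruct (gap_spec d u0 L k (P_Ld_window L d u0 u0_P k)) as [H1 _].
  now rewrite H, Z.add_0_r in H1.
Qed.

Lemma gap_right k n : gap d u0 L k = S n -> gap d u0 L (k + 1) = n.
Proof.
  intros H. destruct (gap_spec d u0 L k (P_Ld_window L d u0 u0_P k)) as [H1 H2].
  assert (H3 := gap_le d u0 L k). rewrite H in H1, H2, H3. apply gap_unique; [lia| |].
  - replace (k + 1 + Z.of_nat n)%Z with (k + Z.of_nat (S n))%Z by lia. easy.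
  - intros i Hi. replace (k + 1 + Z.of_nat i)%Z with (k + Z.of_nat (S i))%Z by lia. apply H2. lia.
Qed.

Lemma gap_left k n : gap d u0 L k = S n -> gap d u0 L (k - 1) = O \/ gap d u0 L (k - 1) = S (S n).
Proof.
  intros H. destruct (gap d u0 L (k - 1)) as [|m] eqn:E; [now left|right].
  apply gap_right in E. replace (k - 1 + 1)%Z with k in E by lia. congruence.
Qed.

End Gap.

(* A sub-solution that depends on space only through the distance to the next site
   charged by the datum.  Since [psi] decreases in that distance, jumping back to distance
   [0] on the left of a charged site only helps. *)
Lemma reg_solution_ge_profile beta L N d u0 e v (psi dpsi : nat -> R -> R) tau :
  beta <> 0 -> beta <= 1 -> (L <= N)%nat -> P_Ld L d u0 ->
  0 < e -> reg_solution beta e u0 v ->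
  (forall n t, 0 <= t <= tau -> continuous (psi n) t) ->
  (forall n t, 0 < t < tau -> is_derive (psi n) t (dpsi n t)) ->
  (forall n t, 0 <= t <= tau -> psi (S n) t <= psi n t) ->
  (forall n t, 0 < t < tau -> 0 < psi n t) ->
  (forall t, 0 <= t <= tau -> psi O t <= d) ->
  (forall n, psi (S n) 0 <= 0) ->
  (forall t, 0 < t < tau -> dpsi O t <= 2 * G beta (psi N t) - 2 * G beta (psi O t)) ->
  (forall n t, (S n <= N)%nat -> 0 < t < tau ->
     dpsi (S n) t <= G beta (psi n t) - 2 * G beta (psi (S n) t) + G beta (psi (S (S n)) t)) ->
  forall k t, 0 <= t <= tau -> psi N t <= v t k.
Proof.
  intros Hb Hb1 HLN HP He Hv Cp Dp Hdec Hpos Hd H0 S0 SS k t Ht.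
  assert (Hdec' : forall t, 0 <= t <= tau -> forall n m, (n <= m)%nat -> psi m t <= psi n t).
  { intros s Hs n m Hnm. induction Hnm as [|m Hnm IH]; [lra|].
    apply Rle_trans with (2 := IH). now apply Hdec. }
  assert (HN : forall j, (gap d u0 L j <= N)%nat) by (intros j; generalize (gap_le d u0 L j); lia).
  apply Rle_trans with (psi (gap d u0 L k) t); [now apply Hdec'|].
  apply (reg_solution_above beta Hb Hb1 e u0 v He Hv 0 tau (fun t k => psi (gap d u0 L k) t)
    (fun t k => dpsi (gap d u0 L k) t) d); auto; try lra.
  - intros j s Hs. unfold Delta.
    (* At a charged site nothing is known about the gaps of the two neighbours, so both are bounded
       from below by the smallest value [psi N]. *)
    assert (GN : forall i, G beta (psi N s) <= G beta (psi (gap d u0 L i) s)).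
    { intros i. apply G_mono; auto. split; [now apply Hpos|]. apply Hdec'; [lra|easy]. }
    destruct (gap d u0 L j) as [|n] eqn:E.
    + generalize (S0 s Hs) (GN (j - 1)%Z) (GN (j + 1)%Z). lra.
    + assert (Hn : (S n <= N)%nat) by (rewrite <- E; apply HN).
      rewrite (gap_right L d u0 HP j n E).
      assert (G beta (psi (S (S n)) s) <= G beta (psi (gap d u0 L (j - 1)) s)).
      { apply G_mono; auto. split; [now apply Hpos|]. apply Hdec'; [lra|].
        destruct (gap_left L d u0 HP j n E) as [-> | ->]; lia. }
      generalize (SS n s Hn Hs). lra.
  - intros j s Hs. apply Rle_trans with (psi O s); [apply Hdec'; [easy|lia]|auto].
  - intros j. destruct Hv as [V0 [V1 _]].
    destruct (gap d u0 L j) as [|n] eqn:E.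
    + rewrite V0. generalize (gap_0 L d u0 HP j E) (Hd 0 ltac:(lra)). lra.
    + generalize (H0 n) (V1 0 j). lra.
Qed.

(** From [tau] on, the constant [phi tau] serves as sub-solution, so the bound reached at that time
    persists. *)
Lemma reg_solution_ge_frozen beta e u0 v (phi : R -> R) tau :
  beta <> 0 -> beta <= 1 -> 0 < e -> reg_solution beta e u0 v ->
  0 < tau -> 0 < phi tau ->
  (forall k t, 0 <= t <= tau -> phi t <= v t k) ->
  forall k t, 0 <= t -> phi (Rmin t tau) <= v t k.
Proof.
  intros Hb Hb1 He Hv Htau Hphi H k t Ht. destruct (Rle_lt_dec t tau) as [Hle|Hlt].
  - rewrite Rmin_left by easy. apply H. lra.
  - rewrite Rmin_right by lra.
    apply (reg_solution_ge_const beta Hb Hb1 e u0 v He Hv tau); try lra.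
    intros j. apply H. lra.
Qed.

Lemma powt_eq t a : 0 < t -> powt t a = Rpower t a.
Proof. intros H. unfold powt. destruct (Rlt_dec 0 t); [easy|lra]. Qed.

Lemma powt_0 a : powt 0 a = 0.
Proof. unfold powt. destruct (Rlt_dec 0 0); [lra|easy]. Qed.

Lemma powt_ge0 t a : 0 <= powt t a.
Proof. unfold powt. destruct (Rlt_dec 0 t); [apply Rlt_le, Rpower_pos|lra]. Qed.

Lemma powt_mono s t a : 0 <= a -> s <= t -> powt s a <= powt t a.
Proof.
  intros Ha Hst. destruct (Rlt_dec 0 s) as [H|H].
  - rewrite !powt_eq by lra. apply Rle_Rpower_l; lra.
  - unfold powt at 1. destruct (Rlt_dec 0 s); [easy|apply powt_ge0].
Qed.

Lemma powt_1 a : powt 1 a = 1.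
Proof. rewrite powt_eq by lra. unfold Rpower. rewrite ln_1, Rmult_0_r. apply exp_0. Qed.

Lemma powt_is_derive t a : 0 < t -> is_derive (fun s => powt s a) t (a * Rpower t (a - 1)).
Proof.
  intros Ht. apply is_derive_ext_loc with (fun s => Rpower s a).
  - exists (mkposreal t Ht). intros s Hs. symmetry. apply powt_eq.
    change (Rabs (s - t) < t) in Hs. apply Rabs_def2 in Hs. lra.
  - apply is_derive_Reals. now apply derivable_pt_lim_power.
Qed.

Lemma powt_continuous t a : 0 < a -> 0 <= t -> continuous (fun s => powt s a) t.
Proof.
  intros Ha [Ht|<-].
  - eapply continuous_of_is_derive. now apply powt_is_derive.
  - apply continuous_R. intros eps He. exists (Rpower eps (/ a)). split; [apply Rpower_pos|].
    intros y Hy. rewrite powt_0, Rminus_0_r in *.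
    rewrite Rabs_pos_eq by apply powt_ge0.
    destruct (Rlt_dec 0 y) as [H|H].
    + rewrite powt_eq by easy. rewrite Rabs_pos_eq in Hy by lra.
      replace eps with (Rpower (Rpower eps (/ a)) a).
      * apply Rlt_Rpower_l; lra.
      * rewrite Rpower_mult, Rinv_l, Rpower_1; lra.
    + unfold powt. destruct (Rlt_dec 0 y); easy.
Qed.

Lemma Rpower_base_1 a : Rpower 1 a = 1.
Proof. unfold Rpower. rewrite ln_1, Rmult_0_r. apply exp_0. Qed.

Lemma G_pos_eq beta x : 0 < beta -> G beta x = Rpower x beta.
Proof. intros H. unfold G. rewrite Rabs_pos_eq, Rdiv_diag by lra. ring. Qed.

Lemma G_neg_eq beta x : beta < 0 -> G beta x = - Rpower x beta.
Proof. intros H. unfold G. rewrite Rabs_left by lra. field. lra. Qed.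

Lemma G_abs beta x : beta <> 0 -> Rabs (G beta x) = Rpower x beta.
Proof.
  intros H. assert (Hp := Rpower_pos x beta). destruct (Rtotal_order beta 0) as [Hb|[Hb|Hb]]; [|easy|].
  - rewrite G_neg_eq by easy. rewrite Rabs_Ropp. apply Rabs_pos_eq; lra.
  - rewrite G_pos_eq by easy. apply Rabs_pos_eq; lra.
Qed.

(* Time profile exponent [g = 1 / (1 - beta)]: since [g * beta = g - 1], the space profile [f] and
   the time profile [t ^ g] separate. *)
Lemma G_selfsimilar beta c t : beta < 1 -> 0 < c -> 0 < t ->
  G beta (c * Rpower t (/ (1 - beta))) = Rpower t (/ (1 - beta) - 1) * G beta c.
Proof.
  intros Hb Hc Ht. unfold G. rewrite <- Rpower_mult_distr by (easy || apply Rpower_pos).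
  rewrite Rpower_mult. replace (/ (1 - beta) * beta) with (/ (1 - beta) - 1) by (field; lra). ring.
Qed.

(* [G (f n)] is [D 2^-n] for [beta > 0] and [- 2^(N+1) (2 - 2^-n)] for [beta < 0]: in both cases
   decreasing and convex. *)
Lemma exists_space_profile beta N : beta <> 0 -> beta < 1 ->
  exists f : nat -> R, (forall n, 0 < f n) /\ (forall n, f (S n) <= f n) /\
    (forall n, (S n <= N)%nat ->
       f (S n) * / (1 - beta) <= G beta (f n) - 2 * G beta (f (S n)) + G beta (f (S (S n)))).
Proof.
  intros Hb0 Hb1.
  assert (Hh : forall n, 0 < (/ 2) ^ n <= 1).
  { induction n as [|n IH]; simpl; lra. }
  destruct (Rtotal_order beta 0) as [Hb|[Hb|Hb]]; [|easy|].
  (* The second difference of [G (f n)] is [A * (/ 2) ^ (n + 2)], at least 1 for [n + 1 <= N] by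
     this choice of [A]. The left side is at most 1, since [f <= 1] and [1 - beta >= 1]. *)
  - set (A := 2 ^ (S N)).
    assert (HA : 1 <= A) by (apply pow_R1_Rle; lra).
    set (p := fun n => A * (2 - (/ 2) ^ n)).
    assert (Hp : forall n, 1 <= p n).
    { intros n. unfold p. assert (1 * 1 <= A * (2 - (/ 2) ^ n)); [|lra].
      apply Rmult_le_compat; generalize (Hh n); lra. }
    exists (fun n => Rpower (p n) (/ beta)).
    assert (Hib : / beta < 0) by now apply Rinv_lt_0_compat.
    assert (Gp : forall n, G beta (Rpower (p n) (/ beta)) = - p n).
    { intros n. rewrite G_neg_eq, Rpower_mult, Rinv_l, Rpower_1; auto. generalize (Hp n); lra. }
    split; [|split].
    + intros n. apply Rpower_pos.
    + intros n. apply Rpower_le_antitone; [lra|]. split; [generalize (Hp n); lra|].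
      unfold p. apply Rmult_le_compat_l; [lra|]. simpl. generalize (Hh n). lra.
    + intros n Hn. rewrite !Gp.
      assert (Q1 : Rpower (p (S n)) (/ beta) <= 1).
      { rewrite <- (Rpower_base_1 (/ beta)). apply Rpower_le_antitone; [lra|]. generalize (Hp (S n)). lra. }
      assert (Q2 : / (1 - beta) <= 1) by (rewrite <- Rinv_1; apply Rinv_le_contravar; lra).
      assert (Q3 : 0 < / (1 - beta)) by (apply Rinv_0_lt_compat; lra).
      assert (Q4 : Rpower (p (S n)) (/ beta) * / (1 - beta) <= 1 * 1).
      { apply Rmult_le_compat; try lra. apply Rlt_le, Rpower_pos. }
      assert (Q5 : 1 <= A * (/ 2) ^ (S (S n))).
      { unfold A. replace (S N) with (S (S n) + (N - S n))%nat by lia.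
        rewrite pow_add. assert (1 <= 2 ^ (N - S n)) by (apply pow_R1_Rle; lra).
        assert (E : 2 ^ S (S n) * (/ 2) ^ S (S n) = 1) by (rewrite <- Rpow_mult_distr, Rinv_r, pow1; lra).
        replace (2 ^ S (S n) * 2 ^ (N - S n) * (/ 2) ^ S (S n))
          with (2 ^ (N - S n) * (2 ^ S (S n) * (/ 2) ^ S (S n))) by ring.
        rewrite E. lra. }
      apply Rle_trans with (1 := Q4). unfold p. simpl in Q5 |- *. lra.
  (* Here [f = p ^ (1 + q)], and [D] is chosen with [D ^ q = (1 - beta) / 2]. This gives
     [f / (1 - beta) <= p / 2], and at rank [n + 1] the right side is exactly the second difference
     of [p]. *)
  - set (q := / beta - 1).
    assert (Hib : 1 < / beta) by (rewrite <- Rinv_1; apply Rinv_lt_contravar; lra).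
    assert (Hq : 0 < q) by (unfold q; lra).
    set (r := (1 - beta) / 2). assert (Hr : 0 < r <= 1) by (unfold r; lra).
    set (D := Rpower r (/ q)).
    assert (HD : 0 < D) by apply Rpower_pos.
    set (p := fun n => D * (/ 2) ^ n).
    assert (Hp : forall n, 0 < p n <= D).
    { intros n. unfold p. split.
      - apply Rmult_lt_0_compat; [easy|apply Hh].
      - rewrite <- (Rmult_1_r D) at 2. apply Rmult_le_compat_l; [lra|apply Hh]. }
    exists (fun n => Rpower (p n) (/ beta)).
    assert (Gp : forall n, G beta (Rpower (p n) (/ beta)) = p n).
    { intros n. rewrite G_pos_eq, Rpower_mult, Rinv_l, Rpower_1; auto. apply Hp. }
    split; [|split].
    + intros n. apply Rpower_pos.
    + intros n. apply Rle_Rpower_l; [lra|]. split; [apply Hp|].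
      unfold p. apply Rmult_le_compat_l; [lra|]. simpl. generalize (Hh n). lra.
    + intros n _. rewrite !Gp.
      replace (/ beta) with (1 + q) by (unfold q; ring).
      rewrite Rpower_plus, Rpower_1 by apply Hp.
      assert (Q : Rpower (p (S n)) q <= r).
      { replace r with (Rpower D q).
        - apply Rle_Rpower_l; [lra|apply Hp].
        - unfold D. rewrite Rpower_mult, Rinv_l, Rpower_1; lra. }
      assert (Q1 : 0 < / (1 - beta)) by (apply Rinv_0_lt_compat; lra).
      assert (Q2 : p (S n) * Rpower (p (S n)) q * / (1 - beta) <= p (S n) * r * / (1 - beta)).
      { apply Rmult_le_compat_r; [lra|]. apply Rmult_le_compat_l; [apply Rlt_le, Hp|easy]. }
      replace (p (S n) * r * / (1 - beta)) with (p (S n) * / 2) in Q2 by (unfold r; field; lra).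
      apply Rle_trans with (1 := Q2). unfold p. simpl. lra.
Qed.

(** The self-similar profile [f n * t ^ g] vanishes at time 0 and cannot describe a charged site.
    There it is replaced by [d - C * (t + t ^ g)], which starts at [d] and stays above the profile
    for a short time. All choices depend on [beta], [L] and [d] only, so [c] is fixed before the
    lift. *)
Lemma reg_solution_lower_bound beta L d : beta <> 0 -> beta < 1 -> 0 < d ->
  exists c, 0 < c /\ forall u0 e v, P_Ld L d u0 -> 0 < e -> reg_solution beta e u0 v ->
    forall k t, 0 <= t -> c * Rmin 1 (powt t (/ (1 - beta))) <= v t k.
Proof.
  intros Hb0 Hb1 Hd. set (g := / (1 - beta)).
  assert (Hg : 0 < g) by (apply Rinv_0_lt_compat; lra).
  (* The depth is [S L] so that the last entry has the form [f n * t ^ g] even when [L = 0]. *)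
  destruct (exists_space_profile beta (S L) Hb0 Hb1) as [f [F1 [F2 F3]]]. fold g in F3.
  (* The value at a charged site falls at rate [C * (1 + g * t ^ (g - 1))]. The constant part pays
     for the outflow, at most [2 * Rabs (G beta d)]; the part in [t ^ (g - 1)] pays for the
     neighbours' term [2 * G beta (psi (S L) t)], which scales in the same way, whence the division
     by [g]. *)
  set (C := 2 * Rabs (G beta d) + 2 * Rabs (G beta (f (S L))) / g).
  assert (HC1 : 2 * Rabs (G beta d) <= C).
  { unfold C. assert (0 <= 2 * Rabs (G beta (f (S L))) / g); [|lra].
    apply Rmult_le_pos; [generalize (Rabs_pos (G beta (f (S L)))); lra|].
    apply Rlt_le, Rinv_0_lt_compat, Hg. }
  assert (HC2 : 2 * Rabs (G beta (f (S L))) <= C * g).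
  { replace (C * g) with (2 * Rabs (G beta d) * g + 2 * Rabs (G beta (f (S L))))
      by (unfold C; field; lra).
    assert (0 <= 2 * Rabs (G beta d) * g); [|lra].
    apply Rmult_le_pos; [generalize (Rabs_pos (G beta d))|]; lra. }
  assert (HC0 : 0 <= C) by (generalize (Rabs_pos (G beta d)); lra).
  (* Up to [tau] the value at a charged site is at least [d / 2] and [f O * t ^ g] at most [d / 2];
     this keeps [psi] decreasing across the change of formula between ranks 0 and 1. *)
  assert (Htau : exists tau, 0 < tau <= 1 /\ forall t, 0 <= t <= tau ->
    C * (t + powt t g) <= d / 2 /\ f O * powt t g <= d / 2).
  { assert (Cc : continuous (fun t => (C + f O) * (t + powt t g)) 0).
    { apply (continuous_mult (fun _ => C + f O)); [apply continuous_const|].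
      apply (continuous_plus (V:=R_NormedModule)); [apply continuous_id|apply powt_continuous; lra]. }
    destruct (proj1 (continuous_R _ _) Cc (d / 2) ltac:(lra)) as [del [Hdel H]].
    exists (Rmin 1 (del / 2)).
    assert (Hm1 := Rmin_l 1 (del / 2)). assert (Hm2 := Rmin_r 1 (del / 2)).
    assert (Hm3 : 0 < Rmin 1 (del / 2)) by (apply Rmin_glb_lt; lra).
    split; [lra|]. intros t Ht.
    assert (Q : Rabs (t - 0) < del) by (rewrite Rabs_right; lra).
    apply H in Q. rewrite powt_0 in Q. apply Rabs_def2 in Q.
    assert (P := powt_ge0 t g).
    assert (0 <= C * (t + powt t g)) by (apply Rmult_le_pos; lra).
    assert (0 <= f O * t) by (apply Rmult_le_pos; [apply Rlt_le, F1|lra]).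
    assert (0 <= f O * powt t g) by (apply Rmult_le_pos; [apply Rlt_le, F1|lra]).
    lra. }
  destruct Htau as [tau [Htau1 Htau]].
  set (psi := fun n t => match n with O => d - C * (t + powt t g) | S _ => f n * powt t g end).
  set (dpsi := fun n t => match n with
    | O => 0 - C * (1 + g * Rpower t (g - 1)) | S _ => f n * (g * Rpower t (g - 1)) end).
  assert (Hpsi0 : forall t, 0 <= t <= tau -> d / 2 <= psi O t <= d).
  { intros t Ht. destruct (Htau t Ht) as [T1 T2]. unfold psi.
    assert (0 <= C * (t + powt t g)) by (apply Rmult_le_pos; [|generalize (powt_ge0 t g)]; lra). lra. }
  assert (Hpsif : forall n t, 0 <= t <= tau -> f n * powt t g <= psi n t).
  { intros [|n] t Ht; [|simpl; lra]. generalize (Htau t Ht) (Hpsi0 t Ht). lra. }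
  exists (f (S L) * powt tau g). split.
  { rewrite powt_eq by lra. apply Rmult_lt_0_compat; [apply F1|apply Rpower_pos]. }
  intros u0 e v HP He Hv k t Ht.
  assert (B : forall k t, 0 <= t <= tau -> psi (S L) t <= v t k).
  { apply (reg_solution_ge_profile beta L (S L) d u0 e v psi dpsi tau); auto; try lra.
    - intros [|n] s Hs; unfold psi.
      + apply (continuous_minus (V:=R_NormedModule)); [apply continuous_const|].
        apply (continuous_mult (fun _ => C)); [apply continuous_const|].
        apply (continuous_plus (V:=R_NormedModule)); [apply continuous_id|apply powt_continuous; lra].
      + apply (continuous_mult (fun _ => f (S n))); [apply continuous_const|apply powt_continuous; lra].
    - intros [|n] s Hs; unfold psi, dpsi.
      + apply (is_derive_minus (V:=R_NormedModule)); [apply (is_derive_const (V:=R_NormedModule))|].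
        apply is_derive_scal. apply (is_derive_plus (V:=R_NormedModule)).
        * apply (is_derive_id (K:=R_AbsRing)).
        * apply powt_is_derive. lra.
      + apply is_derive_scal. apply powt_is_derive. lra.
    - intros n s Hs. apply Rle_trans with (2 := Hpsif n s Hs). simpl.
      apply Rmult_le_compat_r; [apply powt_ge0|apply F2].
    - intros n s Hs. apply Rlt_le_trans with (2 := Hpsif n s ltac:(lra)).
      rewrite powt_eq by lra. apply Rmult_lt_0_compat; [apply F1|apply Rpower_pos].
    - apply Hpsi0.
    - intros n. simpl. rewrite powt_0. lra.
    - intros s Hs. unfold dpsi. set (q := Rpower s (g - 1)).
      assert (Hq : 0 < q) by apply Rpower_pos.
      assert (Q1 : G beta (psi (S L) s) = q * G beta (f (S L))).
      { unfold psi. rewrite powt_eq by lra. apply G_selfsimilar; auto; lra. }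
      assert (Q2 : G beta (psi O s) <= G beta d).
      { apply G_mono; try lra. generalize (Hpsi0 s ltac:(lra)). lra. }
      rewrite Q1. generalize (Rle_abs (G beta d)). intros Q3.
      assert (Q4 : - Rabs (G beta (f (S L))) <= G beta (f (S L))).
      { generalize (Rle_abs (- G beta (f (S L)))). rewrite Rabs_Ropp. lra. }
      assert (Q5 : q * - Rabs (G beta (f (S L))) <= q * G beta (f (S L))) by (apply Rmult_le_compat_l; lra).
      assert (Q6 : q * (2 * Rabs (G beta (f (S L)))) <= q * (C * g)) by (apply Rmult_le_compat_l; lra).
      lra.
    - intros n s Hn Hs. unfold dpsi. set (q := Rpower s (g - 1)).
      assert (Hq : 0 < q) by apply Rpower_pos.
      assert (Q : forall m, G beta (f m * powt s g) = q * G beta (f m)).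
      { intros m. rewrite powt_eq by lra. apply G_selfsimilar; auto; lra. }
      assert (Q1 : q * G beta (f n) <= G beta (psi n s)).
      { rewrite <- Q. apply G_mono; try lra. split; [|apply Hpsif; lra].
        rewrite powt_eq by lra. apply Rmult_lt_0_compat; [apply F1|apply Rpower_pos]. }
      change (psi (S n) s) with (f (S n) * powt s g).
      change (psi (S (S n)) s) with (f (S (S n)) * powt s g). rewrite !Q.
      assert (Q2 := F3 n Hn).
      apply (Rmult_le_compat_l q) in Q2; [|lra]. lra. }
  assert (Hf := F1 (S L)). assert (Ht1 : powt tau g <= 1) by (rewrite <- (powt_1 g); apply powt_mono; lra).
  assert (Ht0 := powt_ge0 tau g).
  apply Rle_trans with (psi (S L) (Rmin t tau)).
  - unfold psi. rewrite Rmult_assoc. apply Rmult_le_compat_l; [lra|].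
    assert (Hm0 : 0 <= Rmin 1 (powt t g)) by (apply Rmin_glb; [lra|apply powt_ge0]).
    unfold Rmin at 2. destruct (Rle_dec t tau) as [Hl|Hl].
    + apply Rle_trans with (1 * Rmin 1 (powt t g)).
      * apply Rmult_le_compat_r; lra.
      * generalize (Rmin_r 1 (powt t g)). lra.
    + rewrite <- (Rmult_1_r (powt tau g)) at 2. apply Rmult_le_compat_l; [lra|apply Rmin_l].
  - apply (reg_solution_ge_frozen beta e u0 v (psi (S L)) tau); auto; try lra.
    simpl. rewrite powt_eq by lra. apply Rmult_lt_0_compat; [lra|apply Rpower_pos].
Qed.

Lemma G_1 x : 0 < x -> G 1 x = x.
Proof. intros H. rewrite G_pos_eq by lra. now apply Rpower_1. Qed.

(** Keeping only the inflow from the neighbour closer to the charged site reduces the heat equation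
    to [psi_n' = psi_(n-1) - 2 psi_n], solved by Poisson weights; the discarded inflow is positive.
    The weights decrease in [n] as long as [t <= 1], so the bound is frozen at time 1, where
    [exp (-2)] comes from. *)
Lemma reg_solution_lower_bound_linear L d u0 e v : 0 < d -> P_Ld L d u0 -> 0 < e -> reg_solution 1 e u0 v ->
  forall k t, 0 <= t -> d * exp (-2) / INR (fact L) * Rmin 1 t ^ L <= v t k.
Proof.
  intros Hd HP He Hv k t Ht.
  assert (HF : forall n, 0 < INR (fact n)) by (intros; apply INR_fact_lt_0).
  assert (HFi : forall n, 0 < / INR (fact n)) by (intros; apply Rinv_0_lt_compat, HF).
  set (psi := fun n t => d * exp (-2 * t) * (t ^ n / INR (fact n))).
  set (dpsi := fun n t => match n with O => 0 | S m => psi m t end - 2 * psi n t).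
  assert (HE : forall s, 0 < d * exp (-2 * s)) by (intros; apply Rmult_lt_0_compat; [easy|apply exp_pos]).
  assert (D : forall n s, is_derive (psi n) s (dpsi n s)).
  { intros [|n] s; unfold psi, dpsi.
    - auto_derive; [easy|]. unfold psi. simpl. field.
    - auto_derive; [easy|]. unfold psi. simpl.
      change (match n with O => 1 | S _ => INR n + 1 end) with (INR (S n)).
      rewrite S_INR, plus_INR, mult_INR.
      field. generalize (HF n) (pos_INR n). split; nra. }
  assert (Hpos : forall n s, 0 < s -> 0 < psi n s).
  { intros n s Hs. apply Rmult_lt_0_compat; [apply HE|]. apply Rmult_lt_0_compat; [now apply pow_lt|apply HFi]. }
  assert (B : forall k t, 0 <= t <= 1 -> psi L t <= v t k).
  { apply (reg_solution_ge_profile 1 L L d u0 e v psi dpsi 1); auto; try lra; try lia.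
    - intros n s Hs. eapply continuous_of_is_derive, D.
    - intros n s Hs. unfold psi. apply Rmult_le_compat_l; [apply Rlt_le, HE|].
      rewrite fact_simpl, mult_INR. unfold Rdiv. rewrite Rinv_mult. simpl pow.
      replace (s * s ^ n * (/ INR (S n) * / INR (fact n))) with ((s * / INR (S n)) * (s ^ n * / INR (fact n))) by ring.
      rewrite <- (Rmult_1_l (s ^ n * / INR (fact n))) at 2.
      apply Rmult_le_compat_r; [apply Rmult_le_pos; [apply pow_le; lra|apply Rlt_le, HFi]|].
      rewrite <- (Rmult_1_l 1). apply Rmult_le_compat; try lra.
      + apply Rlt_le, Rinv_0_lt_compat, lt_0_INR. lia.
      + rewrite <- Rinv_1. apply Rinv_le_contravar; [lra|]. apply (le_INR 1). lia.
    - intros n s Hs. apply Hpos. lra.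
    - intros s Hs. unfold psi. simpl. rewrite Rdiv_1_r, Rmult_1_r.
      rewrite <- (Rmult_1_r d) at 2. apply Rmult_le_compat_l; [lra|].
      rewrite <- exp_0. apply exp_mono. lra.
    - intros n. unfold psi. simpl. rewrite Rmult_0_l. unfold Rdiv. rewrite Rmult_0_l. lra.
    - intros s Hs. unfold dpsi. rewrite !G_1 by (apply Hpos; lra).
      generalize (Hpos L s ltac:(lra)). lra.
    - intros n s Hn Hs. unfold dpsi. rewrite !G_1 by (apply Hpos; lra).
      generalize (Hpos (S (S n)) s ltac:(lra)). lra. }
  apply Rle_trans with (psi L (Rmin t 1)).
  - unfold psi, Rdiv. rewrite (Rmin_comm t 1).
    set (s := Rmin 1 t). assert (Hs : 0 <= s <= 1) by (split; [apply Rmin_glb; lra|apply Rmin_l]).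
    replace (d * exp (-2) * / INR (fact L) * s ^ L) with (d * exp (-2) * (s ^ L * / INR (fact L))) by ring.
    apply Rmult_le_compat_r; [apply Rmult_le_pos; [apply pow_le; lra|apply Rlt_le, HFi]|].
    apply Rmult_le_compat_l; [lra|]. apply exp_mono. lra.
  - apply (reg_solution_ge_frozen 1 e u0 v (psi L) 1); auto; try lra. apply Hpos. lra.
Qed.

(** * Modified Bessel functions *)

Definition bessel_integrand (n : nat) (s th : R) : R := exp (s * cos th) * cos (INR n * th).

Lemma is_RInt_bessel n s : is_RInt (bessel_integrand n s) 0 PI (PI * besselI n s).
Proof.
  unfold besselI. rewrite <- Rmult_assoc, Rinv_r, Rmult_1_l by apply PI_neq0.
  apply (RInt_correct (V:=R_CompleteNormedModule)), (ex_RInt_continuous (V:=R_CompleteNormedModule)).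
  intros z _. apply (ex_derive_continuous (bessel_integrand n s)). unfold bessel_integrand.
  auto_derive. easy.
Qed.

Lemma besselI_abs_le_exp n s : 0 <= s -> Rabs (besselI n s) <= exp s.
Proof.
  intros Hs. assert (HPI := PI_RGT_0).
  assert (B : Rabs (RInt (bessel_integrand n s) 0 PI) <= (PI - 0) * exp s).
  { apply abs_RInt_le_const; [lra|eexists; apply is_RInt_bessel|].
    intros th _. unfold bessel_integrand. rewrite Rabs_mult.
    rewrite <- (Rmult_1_r (exp s)). apply Rmult_le_compat; try apply Rabs_pos.
    - rewrite Rabs_pos_eq by apply Rlt_le, exp_pos. apply exp_mono.
      rewrite <- (Rmult_1_r s) at 2. apply Rmult_le_compat_l; [easy|apply COS_bound].
    - apply Rabs_le, COS_bound. }
  unfold besselI. fold (bessel_integrand n s). rewrite Rabs_mult, Rabs_inv, (Rabs_pos_eq PI) by lra.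
  apply Rmult_le_reg_l with PI; [easy|]. rewrite <- Rmult_assoc, Rinv_r, Rmult_1_l by lra.
  rewrite Rminus_0_r in B. exact B.
Qed.

(** The classical three-term recurrence, without division by [s]: it results from integrating the
    derivative of [exp (s cos th) sin ((n + 1) th)], whose boundary values vanish at 0 and [PI]. *)
Lemma besselI_rec n s : INR (S n) * besselI (S n) s = s / 2 * (besselI n s - besselI (S (S n)) s).
Proof.
  assert (HPI := PI_RGT_0).
  set (h := fun th => exp (s * cos th) * sin (INR (S n) * th)).
  set (dh := fun th => INR (S n) * bessel_integrand (S n) s th
    - s / 2 * (bessel_integrand n s th - bessel_integrand (S (S n)) s th)).
  assert (D : forall th, is_derive h th (dh th)).
  { intros th. unfold h, dh, bessel_integrand. rewrite (S_INR (S n)).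
    replace (INR n) with (INR (S n) - 1) by (rewrite S_INR; ring).
    generalize (INR (S n)). intros N. auto_derive; [easy|].
    replace ((N - 1) * th) with (N * th - th) by ring.
    replace ((N + 1) * th) with (N * th + th) by ring.
    rewrite cos_minus, cos_plus. field. }
  assert (I1 : is_RInt dh 0 PI (h PI - h 0)).
  { apply (is_RInt_derive (V:=R_CompleteNormedModule) h dh); [auto|].
    intros z _. apply (ex_derive_continuous dh). unfold dh, bessel_integrand. auto_derive. easy. }
  assert (I2 : is_RInt dh 0 PI (INR (S n) * (PI * besselI (S n) s)
    - s / 2 * (PI * besselI n s - PI * besselI (S (S n)) s))).
  { apply (is_RInt_minus (V:=R_NormedModule)).
    - apply (is_RInt_scal (V:=R_NormedModule)), is_RInt_bessel.
    - apply (is_RInt_scal (V:=R_NormedModule)), (is_RInt_minus (V:=R_NormedModule)); apply is_RInt_bessel. }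
  assert (E0 : h PI - h 0 = 0).
  { unfold h. rewrite Rmult_0_r, sin_0. replace (sin (INR (S n) * PI)) with 0; [ring|].
    symmetry. apply sin_eq_0_1. exists (Z.of_nat (S n)). now rewrite <- INR_IZR_INZ. }
  apply (is_RInt_unique (V:=R_CompleteNormedModule)) in I1, I2. rewrite I1, E0 in I2.
  apply Rmult_eq_reg_l with PI; lra.
Qed.

(** Each use of the recurrence gains one factor [s]. Since it involves both neighbouring orders, the
    induction needs the bound for every order [m >= n] at once. *)
Lemma besselI_abs_le_pow n m s : 0 <= s -> (n <= m)%nat -> Rabs (besselI m s) <= exp s * s ^ n.
Proof.
  intros Hs. revert m. induction n as [|n IH]; intros m Hm.
  - rewrite pow_O, Rmult_1_r. now apply besselI_abs_le_exp.
  - destruct m as [|m]; [lia|].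
    assert (Hm1 : 1 <= INR (S m)) by (apply (le_INR 1); lia).
    assert (R := besselI_rec m s).
    assert (Q1 := IH m ltac:(lia)). assert (Q2 := IH (S (S m)) ltac:(lia)).
    assert (Q3 : Rabs (besselI m s - besselI (S (S m)) s) <= 2 * (exp s * s ^ n)).
    { apply Rabs_le_between in Q1, Q2. apply Rabs_le. lra. }
    apply Rle_trans with (Rabs (INR (S m) * besselI (S m) s)).
    + rewrite Rabs_mult, (Rabs_pos_eq (INR (S m))) by lra.
      rewrite <- (Rmult_1_l (Rabs (besselI (S m) s))) at 1.
      apply Rmult_le_compat_r; [apply Rabs_pos|easy].
    + rewrite R, Rabs_mult, (Rabs_pos_eq (s / 2)) by lra.
      apply Rle_trans with (s / 2 * (2 * (exp s * s ^ n))); [apply Rmult_le_compat_l; lra|].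
      simpl. right. field.
Qed.

(** The exponential bound serves for [t >= 1] and the power bound for [t < 1]; the factor [2 ^ L]
    stems from the argument [2 * t]. *)
Lemma exp_besselI_le L t : 0 <= t -> exp (- (2 * t)) * besselI L (2 * t) <= 2 ^ L * Rmin 1 t ^ L.
Proof.
  intros Ht.
  assert (E : exp (- (2 * t)) * exp (2 * t) = 1) by (rewrite <- exp_plus, Rplus_opp_l; apply exp_0).
  assert (Hp := exp_pos (- (2 * t))).
  unfold Rmin. destruct (Rle_dec 1 t) as [H|H].
  - rewrite pow1, Rmult_1_r. apply Rle_trans with 1; [|apply pow_R1_Rle; lra].
    rewrite <- E. apply Rmult_le_compat_l; [lra|].
    apply Rle_trans with (1 := Rle_abs _). apply besselI_abs_le_exp. lra.
  - rewrite <- Rpow_mult_distr, <- (Rmult_1_l ((2 * t) ^ L)), <- E, Rmult_assoc.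
    apply Rmult_le_compat_l; [lra|].
    apply Rle_trans with (1 := Rle_abs _). apply besselI_abs_le_pow; [lra|lia].
Qed.

(** * Existence with explicit lower bounds *)

Lemma exists_solution_sublinear beta L d : beta <> 0 -> beta < 1 -> 0 < d ->
  exists c, 0 < c /\ forall u0, P_Ld L d u0 -> exists u, is_solution beta u0 u /\
    (forall t k, 0 <= t -> c * Rmin 1 (powt t (/ (1 - beta))) <= u t k) /\
    (forall c1 c2, (forall k, c1 <= u0 k <= c2) -> forall t k, 0 <= t -> c1 <= u t k <= c2).
Proof.
  intros Hb0 Hb1 Hd.
  destruct (reg_solution_lower_bound beta L d Hb0 Hb1 Hd) as [c [Hc HB]].
  set (g := / (1 - beta)) in *.
  assert (Hg : 0 < g) by (apply Rinv_0_lt_compat; lra).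
  exists c. split; [easy|]. intros u0 HP.
  assert (Hlinf : linf_plus u0) by apply HP. destruct Hlinf as [Hu0 [M HM]].
  assert (HM0 : 0 <= M) by (generalize (HM 0%Z) (Rabs_pos (u0 0%Z)); lra).
  (* Lifted solutions lie between [c * Rmin 1 (t ^ g)] and [M + 1]. At the lower end [G] has
     absolute value [c ^ beta] or [c ^ beta * t ^ (g - 1)], according to the branch of the minimum;
     the sum of both is integrable at 0 because [g > 0]. The factor 4 is that of [Delta_bound]. *)
  set (A := 4 * (Rabs (G beta (M + 1)) + Rpower c beta)).
  set (B := 4 * Rpower c beta).
  apply (exists_solution beta u0 (fun t => c * Rmin 1 (powt t g))
    (fun t => A * t + B / g * powt t g) (fun t => A * 1 + B / g * (g * Rpower t (g - 1)))); auto.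
  - lra.
  - apply HP.
  - intros t Ht. apply Rmult_lt_0_compat; [easy|]. apply Rmin_glb_lt; [lra|].
    rewrite powt_eq by easy. apply Rpower_pos.
  - intros s t Hst. apply Rmult_le_compat_l; [lra|]. apply Rle_min_compat_l, powt_mono; lra.
  - intros e v He Hv. apply HB with (e := e) (u0 := u0); auto; lra.
  - intros t Ht. apply (continuous_plus (V:=R_NormedModule)).
    + apply (continuous_mult (fun _ => A)); [apply continuous_const|apply continuous_id].
    + apply (continuous_mult (fun _ => B / g)); [apply continuous_const|now apply powt_continuous].
  - intros t Ht. apply (is_derive_plus (V:=R_NormedModule)).
    + apply is_derive_scal, (is_derive_id (K:=R_AbsRing)).
    + apply is_derive_scal. now apply powt_is_derive.
  - intros e v He Hv k t Ht.
    set (q := Rpower t (g - 1)). assert (Hq : 0 < q) by apply Rpower_pos.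
    replace (A * 1 + B / g * (g * q)) with (4 * (Rabs (G beta (M + 1)) + Rpower c beta * (1 + q)))
      by (unfold A, B; field; lra).
    apply Delta_bound. intros j.
    assert (Hx : 0 < c * Rmin 1 (powt t g)).
    { apply Rmult_lt_0_compat; [easy|]. apply Rmin_glb_lt; [lra|]. rewrite powt_eq by easy. apply Rpower_pos. }
    assert (Q1 : G beta (c * Rmin 1 (powt t g)) <= G beta (v t j)).
    { apply G_mono; try lra. split; [easy|]. apply HB with (e := e) (u0 := u0); auto; lra. }
    assert (Q2 : G beta (v t j) <= G beta (M + 1)).
    { assert (0 < v t j) by (generalize (proj1 (proj2 Hv) t j); lra).
      apply G_mono; try lra. split; [easy|]. apply Rle_trans with (M + e); [|lra].
      apply (reg_solution_le_const beta Hb0 (Rlt_le _ _ Hb1) e u0); auto; try lra.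
      intros i. apply Rle_trans with (2 := HM i). apply Rle_abs. }
    assert (Q3 : Rabs (G beta (c * Rmin 1 (powt t g))) <= Rpower c beta * (1 + q)).
    { assert (Hcb := Rpower_pos c beta).
      unfold Rmin. destruct (Rle_dec 1 (powt t g)).
      - rewrite Rmult_1_r, G_abs by easy. nra.
      - rewrite powt_eq by easy. unfold g. rewrite G_selfsimilar by lra. fold g. fold q.
        rewrite Rabs_mult, G_abs, (Rabs_pos_eq q) by lra. nra. }
    generalize (Rle_abs (G beta (M + 1))) (Rabs_pos (G beta (M + 1)))
      (Rle_abs (- G beta (c * Rmin 1 (powt t g)))) (Rabs_pos (G beta (c * Rmin 1 (powt t g)))).
    rewrite Rabs_Ropp. intros. apply Rabs_le. lra.
Qed.

Lemma exists_solution_linear L d u0 : 0 < d -> P_Ld L d u0 -> exists u, is_solution 1 u0 u /\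
    (forall t k, 0 <= t -> d * exp (-2) / INR (fact L) * Rmin 1 t ^ L <= u t k) /\
    (forall c1 c2, (forall k, c1 <= u0 k <= c2) -> forall t k, 0 <= t -> c1 <= u t k <= c2).
Proof.
  intros Hd HP.
  assert (Hlinf : linf_plus u0) by apply HP. destruct Hlinf as [Hu0 [M HM]].
  assert (HM0 : 0 <= M) by (generalize (HM 0%Z) (Rabs_pos (u0 0%Z)); lra).
  assert (Hc : 0 < d * exp (-2) / INR (fact L)).
  { apply Rdiv_lt_0_compat; [|apply INR_fact_lt_0]. apply Rmult_lt_0_compat; [easy|apply exp_pos]. }
  apply (exists_solution 1 u0 (fun t => d * exp (-2) / INR (fact L) * Rmin 1 t ^ L)
    (fun t => 4 * (M + 1) * t) (fun t => 4 * (M + 1))); try lra.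
  - apply HP.
  - intros t Ht. apply Rmult_lt_0_compat; [easy|]. apply pow_lt, Rmin_glb_lt; lra.
  - intros s t Hst. apply Rmult_le_compat_l; [lra|]. apply pow_incr.
    split; [apply Rmin_glb; lra|apply Rle_min_compat_l; lra].
  - intros e v He Hv. apply reg_solution_lower_bound_linear with (e := e) (u0 := u0); auto; lra.
  - intros t Ht. apply (continuous_mult (fun _ => 4 * (M + 1))); [apply continuous_const|apply continuous_id].
  - intros t Ht. auto_derive; [easy|ring].
  - intros e v He Hv k t Ht. apply Delta_bound. intros j.
    assert (0 < v t j) by (generalize (proj1 (proj2 Hv) t j); lra).
    rewrite G_1, Rabs_pos_eq by lra. apply Rle_trans with (M + e); [|lra].
    apply (reg_solution_le_const 1 R1_neq_R0 (Rle_refl 1) e u0); auto; try lra.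
    intros i. apply Rle_trans with (2 := HM i). apply Rle_abs.
Qed.

Theorem theoremA3 :
  forall (beta : R), beta <> 0 -> beta <= 1 ->
  forall (L : nat) (d : R), 0 < d ->
  exists cfun : R -> R, (forall M, 0 < cfun M) /\
  forall u0 : Z -> R, P_Ld L d u0 ->
  exists u : R -> Z -> R,
    is_solution beta u0 u /\
    (beta < 1 -> forall t k, 0 <= t ->
       cfun (linf_norm u0) * Rmin 1 (powt t (/ (1 - beta))) <= u t k) /\
    (beta = 1 -> forall t k, 0 <= t ->
       cfun (linf_norm u0) * exp (- (2 * t)) * besselI L (2 * t) <= u t k) /\
    (forall c1 c2 : R, (forall k, c1 <= u0 k <= c2) ->
       forall t k, 0 <= t -> c1 <= u t k <= c2).
Proof.
  intros beta Hb0 Hb1 L d Hd.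
  destruct (Rle_lt_or_eq_dec _ _ Hb1) as [Hb|Hb].
  - destruct (exists_solution_sublinear beta L d Hb0 Hb Hd) as [c [Hc H]].
    exists (fun _ => c). split; [easy|]. intros u0 HP. destruct (H u0 HP) as [u [U1 [U2 U3]]].
    exists u. split; [easy|]. split; [intros _; exact U2|]. split; [lra|exact U3].
  - subst beta. set (c := d * exp (-2) / INR (fact L)).
    assert (Hc : 0 < c).
    { apply Rdiv_lt_0_compat; [|apply INR_fact_lt_0]. apply Rmult_lt_0_compat; [easy|apply exp_pos]. }
    assert (H2 : 0 < 2 ^ L) by (apply pow_lt; lra).
    exists (fun _ => c / 2 ^ L). split; [intros _; now apply Rdiv_lt_0_compat|].
    intros u0 HP. destruct (exists_solution_linear L d u0 Hd HP) as [u [U1 [U2 U3]]].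
    exists u. split; [easy|]. split; [lra|]. split; [|exact U3].
    intros _ t k Ht. apply Rle_trans with (2 := U2 t k Ht). fold c.
    replace (c * Rmin 1 t ^ L) with (c / 2 ^ L * (2 ^ L * Rmin 1 t ^ L)) by (field; lra).
    rewrite Rmult_assoc. apply Rmult_le_compat_l; [now apply Rlt_le, Rdiv_lt_0_compat|].
    now apply exp_besselI_le.
Qed.
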